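(* Let $G$ be a non-amenable graph (connected, of bounded degree, rooted at $0$), and for $a>0$ let $\mathbf X$ be the once-reinforced random walk ORRW($a$) on $G$ started at $0$, with law $\mathbb P^{(a)}$. Then: (a) There exists $a_G\in(0,1)$ such that for all $a\in(a_G,1)$ there exist $C>0$ and $\beta>0$ (depending on $a$) with $$\mathbb P^{(a)}(X_{\tau_n}=0)\le C e^{-\beta n}\qquad\text{for all } n;$$ consequently the process is transient for those choices of $a$. (b) For all $a\in(0,1)$, $$\mathbb P^{(a)}\left(\{\mathbf X\text{ is recurrent}\}\cap\Bigl\{\lim_{t\to\infty}\frac{|\mathfrak C_t|}{t}=0\Bigr\}\right)=0.$$
   Context: A graph $G=(V,E)$ is non-amenable if there is a constant $\gamma_G>0$ such that for every finite subgraph $G_0\subset G$, $\mathrm{Card}(\partial^{out}G_0)\ge\gamma_G\,\mathrm{Card}(G_0)$, where $\mathrm{Card}(G_0)$ is the number of vertices of $G_0$ and $\partial^{out}G_0$ is the set of vertices outside $G_0$ at distance one from $G_0$. ORRW($a$): the right-continuous nearest-neighbour continuous-time process $(X_t)_{t\ge0}$ on $V$ with $X_0=0$ such that, with $\mathfrak C_t$ the set of (unoriented) edges traversed by time $t$ and $\mathcal F_t=\sigma(X_s:s\le t)$, on $\{X_t=i\}$ and for every neighbour $j$ of $i$, $\mathbb P(X_{t+h}=j\mid\mathcal F_t)=h\mathbf 1_{\{\{i,j\}\in\mathfrak C_t\}}+a h\mathbf 1_{\{\{i,j\}\notin\mathfrak C_t\}}+o(h)$, and the probability of more than one jump in $(t,t+h)$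 is $o(h)$. $\tau_0=0$ and $\tau_n=\inf\{t>\tau_{n-1}:X_t\ne X_{\tau_{n-1}}\}$. ''Recurrent'' means that the root $0$ is visited at infinitely many jump times $\tau_n$; ''transient'' means that almost surely $0$ is visited at only finitely many jump times. $|\cdot|$ denotes cardinality. *)

(* Defs.v *)
From HB Require Import structures.
From mathcomp Require Import all_boot all_order all_algebra finmap.
From mathcomp Require Import all_classical all_reals all_analysis.

Set Implicit Arguments.
Unset Strict Implicit.
Unset Printing Implicit Defensive.
Import Order.TTheory GRing.Theory Num.Theory.
Import numFieldNormedType.Exports.
Local Open Scope classical_set_scope.
Local Open Scope ring_scope.

Section Graphs.
Variables (V : choiceType) (e : rel V).

Definition simple_graph : Prop := symmetric e /\ irreflexive e.

Definition connected_graph : Prop :=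
  forall x y : V, exists2 p : seq V, path e x p & last x p = y.

Definition bounded_degree : Prop :=
  exists D : nat, forall x : V, ([set y | e x y] #<= `I_D)%card.

Definition outer_boundary (A : set V) : set V :=
  [set y | ~ A y /\ exists2 x, A x & e x y].

(* Only the vertex set of a finite subgraph enters the condition. *)
Definition non_amenable (R : realType) : Prop :=
  exists2 gamma : R, 0 < gamma &
    forall A : set V, finite_set A ->
      (gamma%:E * counting A <= counting (outer_boundary A))%E.

End Graphs.

(* A path is a function on R of which only the restriction to [0, +oo[ is
   relevant. *)
Section Paths.
Variables (R : realType) (V : choiceType).
Implicit Type x : R -> V.

(* Once a path has stopped jumping, all later jump times are +oo. *)
Fixpoint jump_time x (n : nat) : \bar R :=
  match n with
  | 0 => 0%E
  | m.+1 => if jump_time x m is s%:E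
            then ereal_inf [set t%:E | t in [set t | s < t /\ x t <> x s]]
            else +oo%E
  end.

(* Meaningful only when [jump_time x n] is finite. *)
Definition skeleton x (n : nat) : V := x (fine (jump_time x n)).

Definition at_jump x (n : nat) (v : V) : Prop :=
  (jump_time x n < +oo)%E /\ skeleton x n = v.

Definition right_continuous_path x : Prop :=
  forall t, 0 <= t -> \forall s \near t^'+, x s = x t.

Definition nearest_neighbour_path (e : rel V) x : Prop :=
  forall n, (jump_time x n.+1 < +oo)%E -> e (skeleton x n) (skeleton x n.+1).

(* The unoriented edge between i and j is encoded as [fset i; j]. *)
Definition traversed x (t : R) : set {fset V} :=
  [set [fset skeleton x n; skeleton x n.+1]%fset
    | n in [set n | (jump_time x n.+1 <= t%:E)%E]].

Definition recurrent_path x (o : V) : Prop :=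
  infinite_set [set n | at_jump x n o].

(* Two jumps in an open interval: some pair of consecutive jump times in it. *)
Definition two_jumps x (t u : R) : Prop :=
  exists n, (t%:E < jump_time x n)%E /\ (jump_time x n.+1 < u%:E)%E.

End Paths.

Section ConditionalProbability.
Variables (R : realType) (d : measure_display) (T : measurableType d).

Definition is_cond_prob (P : probability T R) (F : set (set T)) (B : set T)
    (Y : T -> R) : Prop :=
  [/\ forall U : set R, measurable U -> F (Y @^-1` U),
      P.-integrable setT (EFin \o Y) &
      forall A, F A -> (\int[P]_(w in A) (Y w)%:E)%E = P (A `&` B)].

End ConditionalProbability.

Section ORRW.
Variables (R : realType) (d : measure_display) (T : measurableType d).
Variables (V : choiceType) (e : rel V).
Implicit Type X : T -> R -> V.

Definition natural_filtration X (t : R) : set (set T) :=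
  <<s [set A | exists s v, 0 <= s <= t /\ A = [set w | X w s = v]] >>.

Definition jump_rate (a : R) (x : R -> V) (t : R) (i j : V) : R :=
  if `[< traversed x t [fset i; j]%fset >] then 1 else a.

(* The terms o(h) are bounded by one deterministic function r, uniformly in the
   time t, the sample point and the vertices.  Uniformity in t is essential: if
   r could depend on t, processes with additional jumps at deterministic times
   would not be excluded.  The o(h) bounds hold for the actual walk
   because its total jump rate is bounded when the degree is. *)
Definition is_ORRW (a : R) (o : V) (P : probability T R) X : Prop :=
  [/\ (forall t v, 0 <= t -> measurable [set w | X w t = v]),
      (forall w, [/\ X w 0 = o, right_continuous_path (X w)
                   & nearest_neighbour_path e (X w)]) &
      exists r : R -> R,
        [/\ r =o_ (0^'+) (id : R -> R),
            (forall t h i j, 0 <= t -> 0 < h -> e i j ->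
              exists2 Y : T -> R,
                is_cond_prob P (natural_filtration X t)
                  [set w | X w (t + h) = j] Y &
                {ae P, forall w, X w t = i ->
                  `|Y w - h * jump_rate a (X w) t i j| <= r h}) &
            (forall t h, 0 <= t -> 0 < h ->
              (P [set w | two_jumps (X w) t (t + h)] <= (r h)%:E)%E)]].

Definition transient (o : V) (P : probability T R) X : Prop :=
  {ae P, forall w, finite_set [set n | at_jump (X w) n o]}.

End ORRW.

(* Main.v *)
Require Import Defs.
From HB Require Import structures.
From mathcomp Require Import all_boot all_order all_algebra finmap.
From mathcomp Require Import all_classical all_reals all_analysis.
From mathcomp Require Import measurable_realfun ring lra zify.
Set Implicit Arguments.
Unset Strict Implicit.
Unset Printing Implicit Defensive.
Import Order.TTheory GRing.Theory Num.Theory.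
Import numFieldNormedType.Exports.
Local Open Scope classical_set_scope.
Local Open Scope ring_scope.

(* The simple random walk on a non-amenable graph of bounded degree returns to
   its root at step n with probability at most rho^n for some rho < 1 (Kesten).
   A step of ORRW(a) has probability 1/deg where all incident edges are known,
   and at most 1/(a deg) otherwise; hence
     E[a^K; X_(tau_n) = 0] <= rho^n,
   where K counts the steps taken before tau_n from a vertex with an untraversed
   edge.  As K <= n, this gives (a) with C = 1 and e^(-beta) = rho/a for a > rho.
   For (b), each such step uses a new edge with probability at least a/deg, so
   K <= delta n outside an exponentially small event as soon as the range is at
   most eps n; by Borel-Cantelli, almost surely 0 is visited only finitely often
   while the range is at most eps n.  Since tau_n <= 4n/a eventually, a range
   that is o(t) is also o(n).

   The law of the jump chain is extracted from the infinitesimal description on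
   a time grid of mesh h: summing the o(h) estimates against powers of
   1/(1 - eta h) and letting h tend to 0 bounds
   P(the jump chain starts with s, tau_n > u) by
   e^(-eta u) prod c_k/(R_k - eta), where c_k is the rate of the k-th jump of s
   and R_k the total jump rate before it. *)

(** * Spectral gap of the simple random walk *)

(** Kesten's bound is proved by Cheeger's argument. Every function that occurs there is an iterate
    of the walk operator on a Dirac mass, hence finitely supported, so finite lists of vertices
    carry all the sums. The obstacle on the probabilistic side is that the process is given only
    through o(h) estimates: neither exponential clocks nor a strong Markov property is available for
    its jump chain. Upper bounds suffice, however, and these follow from a recursion along one fixed
    history: the probability of having reached a history bounds the time spent at its end, and that
    time bounds the probability of reaching each extension. One inequality with a free parameter
    [eta] then serves twice: [eta = 0] bounds the law of the jump chain, and [eta = a / 2] bounds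
    the upper tail of tau_n. Expectations along the jump chain become finite sums over histories,
    estimated one step at a time. *)

Section SpectralGap.
Variables (R : realType) (V : choiceType) (e : rel V).
Variables (nb : V -> seq V) (D : nat) (gamma : R).
Hypothesis e_sym : symmetric e.
Hypothesis nbE : forall x y, (y \in nb x) = e x y.
Hypothesis nb_uniq : forall x, uniq (nb x).
Hypothesis nb_size : forall x, (size (nb x) <= D)%N.
Hypothesis nb_nonempty : forall x, (0 < size (nb x))%N.
Hypothesis gamma_gt0 : 0 < gamma.
Hypothesis isoperimetry : forall S B : seq V, uniq S -> uniq B ->
  {in S, forall x, {subset nb x <= B}} ->
  gamma * (size S)%:R <=
    (size [seq y <- B | (y \notin S) && has (fun x => e x y) S])%:R.

Let deg x : R := (size (nb x))%:R.
Let adj x y : R := (e x y)%:R.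

Definition supported (f : V -> R) (S : seq V) := forall x, x \notin S -> f x = 0.

Lemma sum_supported (f : V -> R) (S B : seq V) : uniq S -> uniq B ->
  {subset S <= B} -> supported f S -> \sum_(x <- B) f x = \sum_(x <- S) f x.
Proof.
move=> uS uB SB fS; rewrite (bigID (mem S)) /= [X in _ + X]big1 ?addr0; last first.
  by move=> x xS; exact: fS.
rewrite -big_filter; apply: perm_big; apply: uniq_perm => //.
  exact: filter_uniq.
move=> x; rewrite mem_filter andb_idr //; exact: SB.
Qed.

Lemma sum_adj (B : seq V) x (f : V -> R) : uniq B -> {subset nb x <= B} ->
  \sum_(y <- B) adj x y * f y = \sum_(y <- nb x) f y.
Proof.
move=> uB nB; rewrite (@sum_supported _ (nb x)) //.
  by rewrite big_seq [RHS]big_seq; apply: eq_bigr => y; rewrite nbE /adj => ->; rewrite mul1r.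
by move=> y; rewrite nbE /adj => /negbTE ->; rewrite mul0r.
Qed.

Lemma adjC x y : adj x y = adj y x. Proof. by rewrite /adj e_sym. Qed.

Lemma adj_ge0 x y : 0 <= adj x y. Proof. exact: ler0n. Qed.

Section Box.
Variables (B : seq V) (uB : uniq B).

(** The box [B] stands for the whole vertex set: for functions supported in an inner [S], no edge
    that matters is cut off by summing over [B] only. *)
Definition inner (S : seq V) :=
  [/\ uniq S, {subset S <= B} & {in S, forall x, {subset nb x <= B}}].

(** In the space weighted by the degree, [mass] is the squared norm and [form] the bilinear form of
    the walk operator, which is symmetric there. *)
Let form f g := \sum_(x <- B) \sum_(y <- B) adj x y * (f x * g y).
Let mass f := \sum_(x <- B) deg x * f x ^+ 2.

Lemma sum_adj_deg S f : inner S -> supported f S ->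
  \sum_(x <- B) \sum_(y <- B) adj x y * f x = \sum_(x <- B) deg x * f x.
Proof.
move=> [uS SB nS] fS; rewrite big_seq [RHS]big_seq; apply: eq_bigr => x xB.
have [xS|xS] := boolP (x \in S).
  rewrite (sum_adj (fun=> f x)) //; last exact: nS.
  by rewrite big_const_seq count_predT iter_addr_0 mulr_natl.
by rewrite fS // mulr0 big1 // => y _; rewrite mulr0.
Qed.

(** Each boundary vertex receives at least one cut edge, and the double sum over ordered pairs
    counts every cut edge twice. Dividing by [D] passes from the number of vertices to the sum of
    degrees. *)
Lemma isoperimetry_indicator S : inner S ->
  2 * (gamma / D%:R) * \sum_(x <- B) deg x * (x \in S)%:R <=
  \sum_(x <- B) \sum_(y <- B) adj x y * `|(x \in S)%:R - (y \in S)%:R|.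
Proof.
move=> [uS SB nS].
pose bd := [seq y <- B | (y \notin S) && has (fun x => e x y) S].
have cut : (size bd)%:R <= \sum_(x <- B) \sum_(y <- B | y \notin S) adj x y * (x \in S)%:R.
  rewrite exchange_big /= (bigID [pred y | has (fun x => e x y) S]) /=.
  rewrite -[leLHS]addr0 lerD //; last first.
    by apply: sumr_ge0 => y _; apply: sumr_ge0 => x _; rewrite mulr_ge0.
  rewrite -sum1_size natr_sum big_filter; apply: ler_sum => y /andP[yS /hasP[x xS xy]].
  rewrite (bigD1_seq x) ?SB //= xS /adj xy mulr1 lerDl.
  by apply: sumr_ge0 => z _; rewrite mulr_ge0.
have cut2 : \sum_(x <- B) \sum_(y <- B) adj x y * `|(x \in S)%:R - (y \in S)%:R| =
    2 * \sum_(x <- B) \sum_(y <- B | y \notin S) adj x y * (x \in S)%:R.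
  under eq_bigr => x _ do rewrite (bigID (mem S)) /=.
  rewrite big_split /= addrC mulr2n mulrDl mul1r; congr (_ + _).
    apply: eq_bigr => x _; apply: eq_bigr => y /negbTE ->.
    by rewrite subr0 ger0_norm.
  under eq_bigr => x _ do rewrite big_mkcond.
  rewrite exchange_big /=; apply: eq_bigr => x _.
  rewrite [RHS]big_mkcond; apply: eq_bigr => y _.
  rewrite adjC; case: (x \in S); case: (y \in S) => //=; rewrite ?mulr0 //.
  - by rewrite subrr normr0 mulr0.
  - by rewrite sub0r normrN normr1.
rewrite cut2 -mulrA ler_pM2l // (le_trans _ cut) // (le_trans _ (isoperimetry uS uB nS)) //.
rewrite -mulrA ler_pM2l //.
rewrite (@sum_supported _ S) //; last by move=> x /negbTE ->; rewrite mulr0.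
case: S uS SB nS {bd cut cut2} => [|x0 S] uS SB nS; first by rewrite big_nil mulr0.
have D0 : 0 < D%:R :> R.
  by rewrite ltr0n; apply: leq_trans (nb_size x0); exact: nb_nonempty.
rewrite mulrC ler_pdivrMr // -natrM mulnC -sum1_size big_distrr /= natr_sum.
rewrite big_seq [leRHS]big_seq; apply: ler_sum => x ->.
by rewrite mulr1 muln1 ler_nat nb_size.
Qed.

(** Discrete co-area formula, by peeling off layers: subtracting the minimum of [f] over [S] removes
    a vertex from the support. Since [f] is at least this minimum on [S], the differences along
    edges split without cancellation into those of the layer and those of the remainder. *)
Lemma coarea_ineq S f : inner S -> supported f S -> (forall x, 0 <= f x) ->
  2 * (gamma / D%:R) * \sum_(x <- B) deg x * f x <=
  \sum_(x <- B) \sum_(y <- B) adj x y * `|f x - f y|.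
Proof.
have [n] := ubnP (size S); elim: n S f => // n IH S f Sn [uS SB nS] fS f0.
have [S0|Sne] := eqVneq S [::].
  rewrite big1 ?mulr0; last by move=> x _; rewrite fS ?S0 ?mulr0.
  by apply: sumr_ge0 => x _; apply: sumr_ge0 => y _; rewrite mulr_ge0 ?adj_ge0.
have [x0 x0S x0min] : exists2 x0, x0 \in S & {in S, forall x, f x0 <= f x}.
  case: S Sne {Sn uS SB nS fS} => // x S _.
  elim: S x => [|y S IHS] x.
    by exists x; rewrite ?inE // => z; rewrite inE => /eqP ->.
  have [x1 x1S x1min] := IHS y.
  have [le|lt] := leP (f x) (f x1).
    exists x; rewrite ?inE ?eqxx // => z; rewrite inE => /orP[/eqP ->//|/x1min].
    exact: le_trans.
  exists x1 => [|z]; first by rewrite inE x1S orbT.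
  rewrite inE => /orP[/eqP ->|/x1min //].
  exact: ltW.
set m := f x0; pose g x := if x \in S then f x - m else 0.
have gS : supported g (rem x0 S).
  move=> x; rewrite mem_rem_uniq // inE negb_and negbK /g.
  by case/orP => [/eqP ->|/negbTE ->//]; rewrite x0S subrr.
have fE x : f x = m * (x \in S)%:R + g x.
  rewrite /g; case: ifPn => xS; first by rewrite mulr1 addrC subrK.
  by rewrite fS // mulr0 addr0.
have g0 x : 0 <= g x by rewrite /g; case: ifPn => // /x0min; rewrite subr_ge0.
have m0 : 0 <= m by exact: f0.
have absE x y : `|f x - f y| = m * `|(x \in S)%:R - (y \in S)%:R| + `|g x - g y|.
  have ge z : z \in S -> 0 <= f z - m by move=> /x0min; rewrite subr_ge0.
  rewrite !fE /g; case: ifPn => xS; case: ifPn => yS.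
  - by rewrite !subrr normr0 mulr0 add0r; congr `|_|; ring.
  - rewrite !mulr1 mulr0 addr0 !subr0 normr1 mulr1.
    by rewrite (ger0_norm (ge _ xS)) ger0_norm // addr_ge0 ?ge.
  - rewrite !mulr1 mulr0 addr0 !sub0r !normrN normr1 mulr1.
    by rewrite (ger0_norm (ge _ yS)) ger0_norm // addr_ge0 ?ge.
  - by rewrite !mulr0 !subrr normr0 mulr0 addr0.
rewrite (eq_bigr (fun x => m * (deg x * (x \in S)%:R) + deg x * g x)); last first.
  by move=> x _; rewrite fE; ring.
rewrite big_split /= -mulr_sumr.
under [leRHS]eq_bigr => x _ do under eq_bigr => y _ do rewrite absE mulrDr mulrCA.
under [leRHS]eq_bigr => x _ do rewrite big_split /= -mulr_sumr.
rewrite [leRHS]big_split /= -mulr_sumr mulrDr mulrCA lerD //.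
  by rewrite ler_wpM2l // isoperimetry_indicator.
apply: (IH (rem x0 S)) => //.
  by rewrite size_rem // prednK // ?lt0n ?size_eq0 //.
split; first exact: rem_uniq.
  by move=> x /mem_rem /SB.
by move=> x /mem_rem /nS.
Qed.


Variables (t : R).
Hypothesis t_gt1 : 1 < t.
Hypothesis t_gamma : 2 / t <= gamma / D%:R.

Let rho := (t ^+ 2 - 3) / (t ^+ 2 - 1).

(** Cheeger's inequality: the co-area bound is applied to the square of [u]. A weighted AM-GM
    inequality with parameter [t] takes the place of Cauchy-Schwarz, so that the estimate stays
    linear in [form] and [mass]. *)
Lemma form_le_nonneg S u : inner S -> supported u S -> (forall x, 0 <= u x) ->
  form u u <= rho * mass u.
Proof.
move=> iS uS u0.
have t0 : 0 < t by apply: lt_trans t_gt1.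
have uS2 : supported (fun x => u x ^+ 2) S by move=> x /uS ->; rewrite expr0n.
have massE : \sum_(x <- B) \sum_(y <- B) adj x y * u x ^+ 2 = mass u.
  exact: (sum_adj_deg iS uS2).
have massE' : \sum_(x <- B) \sum_(y <- B) adj x y * u y ^+ 2 = mass u.
  rewrite exchange_big /= -massE; apply: eq_bigr => x _; apply: eq_bigr => y _.
  by rewrite adjC.
have mass0 : 0 <= mass u.
  by apply: sumr_ge0 => x _; rewrite mulr_ge0 ?sqr_ge0 ?ler0n.
have := coarea_ineq iS uS2 (fun x => sqr_ge0 (u x)).
rewrite -/(mass u) => co.
have : \sum_(x <- B) \sum_(y <- B) adj x y * `|u x ^+ 2 - u y ^+ 2| <=
   \sum_(x <- B) \sum_(y <- B) ((t + t^-1) / 2 * (adj x y * u x ^+ 2) +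
     (t + t^-1) / 2 * (adj x y * u y ^+ 2) + (t^-1 - t) * (adj x y * (u x * u y))).
  apply: ler_sum => x _; apply: ler_sum => y _.
  (* With p = |u x - u y| and q = u x + u y, the bound is p q <= (t p^2 + q^2 / t) / 2. *)
  rewrite [leRHS](_ : _ = adj x y *
    ((t * (u x - u y) ^+ 2 + t^-1 * (u x + u y) ^+ 2) / 2)); last by field; exact: lt0r_neq0.
  rewrite ler_wpM2l // ler_pdivlMr // subr_sqr normrM (ger0_norm (addr_ge0 (u0 x) (u0 y))).
  rewrite -[X in t * X](ger0_norm (sqr_ge0 _)) normrX.
  set p := `|_|; set q := u x + u y.
  rewrite -subr_ge0 (_ : _ - _ = t^-1 * (t * p - q) ^+ 2); last by field; exact: lt0r_neq0.
  by rewrite mulr_ge0 ?sqr_ge0 // invr_ge0 ltW.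
under [leRHS]eq_bigr => x _ do rewrite !big_split /= -!mulr_sumr.
rewrite !big_split /= -!mulr_sumr massE massE' -/(form u u).
move/(le_trans co); move: (form u u) (mass u) mass0 => F M M0 FM.
have FM' : 2 * (2 / t) * M <= (t + t^-1) / 2 * M + (t + t^-1) / 2 * M + (t^-1 - t) * F.
  by apply: le_trans FM; rewrite ler_wpM2r // ler_wpM2l.
(* Solving this inequality for [F] produces the value of [rho]. *)
have {FM'} : 4 * M <= (t ^+ 2 + 1) * M + (1 - t ^+ 2) * F.
  move: FM'; rewrite -(ler_pM2l t0).
  rewrite (_ : t * (2 * _ * M) = 4 * M); last by field; exact: lt0r_neq0.
  rewrite [leRHS](_ : _ = (t ^+ 2 + 1) * M + (1 - t ^+ 2) * F) //; field; exact: lt0r_neq0.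
have t2 : 0 < t ^+ 2 - 1 by rewrite subr_gt0 exprn_egt1.
rewrite /rho mulrAC ler_pdivlMr //; lra.
Qed.

(** Replacing [u] by its absolute value keeps the mass and can only raise the form. This also
    controls the negative end of the spectrum, which matters on bipartite graphs. *)
Lemma form_abs_le S u : inner S -> supported u S -> `|form u u| <= rho * mass u.
Proof.
move=> iS uS; pose v x := `|u x|.
have -> : mass u = mass v by apply: eq_bigr => x _; rewrite /v -normrX ger0_norm ?sqr_ge0.
apply: le_trans (form_le_nonneg iS _ (fun=> normr_ge0 _)) => [|x /uS]; last first.
  by rewrite /v => ->; rewrite normr0.
apply: le_trans (ler_norm_sum _ _ _) _; apply: ler_sum => x _.
apply: le_trans (ler_norm_sum _ _ _) _; apply: ler_sum => y _.
by rewrite !normrM /v (ger0_norm (adj_ge0 _ _)).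
Qed.

Lemma form_polarization f g :
  form (fun x => f x + g x) (fun x => f x + g x) -
  form (fun x => f x - g x) (fun x => f x - g x) = 4 * form f g.
Proof.
have formC : form g f = form f g.
  rewrite /form exchange_big; apply: eq_bigr => x _; apply: eq_bigr => y _ /=.
  by rewrite (adjC y x) (mulrC (g y)).
rewrite (_ : 4 * _ = 2 * form f g + 2 * form g f); last by rewrite formC; ring.
rewrite /form -sumrB !mulr_sumr -big_split; apply: eq_bigr => x _ /=.
by rewrite -sumrB !mulr_sumr -big_split; apply: eq_bigr => y _ /=; ring.
Qed.

Lemma mass_parallelogram f g :
  mass (fun x => f x + g x) + mass (fun x => f x - g x) = 2 * mass f + 2 * mass g.
Proof.
by rewrite /mass !mulr_sumr -!big_split; apply: eq_bigr => x _ /=; ring.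
Qed.

Definition srw (g : V -> R) x := (\sum_(y <- nb x) g y) / deg x.

(** A symmetric operator has norm at most its numerical radius: polarisation is applied to [g] and a
    multiple of [srw g]. The multiple [rho^-1] is the optimal one. *)
Lemma srw_mass_le S g : inner S -> supported g S -> supported (srw g) S -> 0 < rho ->
  mass (srw g) <= rho ^+ 2 * mass g.
Proof.
move=> iS gS fS rho0; pose f x := rho^-1 * srw g x.
have fS' : supported f S by move=> x /fS; rewrite /f => ->; rewrite mulr0.
have deg0 x : 0 < deg x by rewrite ltr0n.
have formE : form f g = rho^-1 * mass (srw g).
  rewrite /form /mass mulr_sumr; apply: eq_big_seq => x xB.
  under eq_bigr => y _ do rewrite mulrCA.
  rewrite -mulr_sumr /f -mulrA; congr (_ * _).
  have [xS|/fS ->] := boolP (x \in S); last by rewrite expr0n /= mulr0 mul0r.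
  rewrite sum_adj //; last by case: iS => _ _ /(_ _ xS).
  rewrite /srw; move: (rho^-1) (lt0r_neq0 (deg0 x)) => r dx; field; exact: dx.
have massf : mass f = rho^-1 ^+ 2 * mass (srw g).
  by rewrite /mass mulr_sumr; apply: eq_bigr => x _; rewrite /f; ring.
have addS : supported (fun x => f x + g x) S.
  by move=> x xS; rewrite fS' // gS // addr0.
have subS : supported (fun x => f x - g x) S.
  by move=> x xS; rewrite fS' // gS // subr0.
have h1 := le_trans (ler_norm _) (form_abs_le iS addS).
have h2 : - form (fun x => f x - g x) (fun x => f x - g x) <=
    rho * mass (fun x => f x - g x).
  by apply: le_trans (form_abs_le iS subS); rewrite -normrN ler_norm.
have := lerD h1 h2; rewrite form_polarization -mulrDr mass_parallelogram formE massf.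
set M := mass (srw g); set N := mass g.
rewrite (_ : rho * _ = 2 * (rho^-1 * M) + 2 * (rho * N)); last first.
  by field; exact: lt0r_neq0.
move=> h; have {h} : rho^-1 * M <= rho * N by lra.
by rewrite ler_pdivrMl // mulrA expr2.
Qed.

End Box.

Fixpoint graph_ball (o : V) n : seq V :=
  if n is m.+1 then undup (graph_ball o m ++ flatten (map nb (graph_ball o m))) else [:: o].

Lemma graph_ball_uniq o n : uniq (graph_ball o n).
Proof. by case: n => //= n; exact: undup_uniq. Qed.

Lemma sub_graph_ballS o n : {subset graph_ball o n <= graph_ball o n.+1}.
Proof. by move=> x xn; rewrite /= mem_undup mem_cat xn. Qed.

Lemma nb_graph_ballS o n x : x \in graph_ball o n -> {subset nb x <= graph_ball o n.+1}.
Proof.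
move=> xn y yx; rewrite /= mem_undup mem_cat; apply/orP; right.
by apply/flattenP; exists (nb x) => //; exact: map_f.
Qed.

Definition dirac_at (o x : V) : R := (x == o)%:R.

Variables (t : R).
Hypothesis t_gt2 : 2 <= t.
Hypothesis t_gamma : 2 / t <= gamma / D%:R.
Let rho := (t ^+ 2 - 3) / (t ^+ 2 - 1).

(** The value at [o] is a single coordinate: its square times [deg o] is at most the mass of the
    iterate, which started at [deg o] and shrinks by [rho ^+ 2] at each step. *)
Lemma srw_return o n : iter n srw (dirac_at o) o <= rho ^+ n.
Proof.
have t2 : 4 <= t ^+ 2.
  have -> : 4 = 2 * 2 :> R by ring.
  by rewrite expr2; apply: ler_pM.
have rho0 : 0 < rho by rewrite divr_gt0 //; lra.
have deg0 x : 0 < deg x by rewrite ltr0n.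
pose f k := iter k srw (dirac_at o).
have f0 k x : 0 <= f k x.
  elim: k x => [|k IH] x; first exact: ler0n.
  by rewrite /f /= /srw divr_ge0 ?ler0n // sumr_ge0 // => y _; exact: IH.
have fS k : supported (f k) (graph_ball o k).
  elim: k => [|k IH] x; first by rewrite /= inE /f /= /dirac_at => /negbTE ->.
  move=> xk; rewrite /f /= /srw big_seq big1 ?mul0r // => y; rewrite nbE => xy.
  apply: IH; apply: contra xk => yk; apply: (nb_graph_ballS yk).
  by rewrite nbE e_sym.
have fm k B : uniq B -> {subset graph_ball o k <= B} ->
    \sum_(x <- B) deg x * f k x ^+ 2 = \sum_(x <- graph_ball o k) deg x * f k x ^+ 2.
  move=> uB kB; apply: sum_supported => //; first exact: graph_ball_uniq.
  by move=> x /fS ->; rewrite expr0n mulr0.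
have massn k : \sum_(x <- graph_ball o k) deg x * f k x ^+ 2 <= rho ^+ (2 * k) * deg o.
  elim: k => [|k IH].
    by rewrite big_seq1 /f /= /dirac_at eqxx expr1n mulr1 mul1r.
  (* The iterate after the step lives on the ball of radius [k.+1]; one more layer contains the
     neighbours of that ball. *)
  have iS : inner (graph_ball o k.+2) (graph_ball o k.+1).
    split; [exact: graph_ball_uniq|exact: sub_graph_ballS|by move=> x /nb_graph_ballS].
  have gS : supported (f k) (graph_ball o k.+1).
    by move=> x xk; apply: fS; apply: contra xk => /sub_graph_ballS.
  have t1 : 1 < t by apply: lt_le_trans t_gt2; rewrite ltr1n.
  have := srw_mass_le (graph_ball_uniq o k.+2) t1 t_gamma iS gS (fS k.+1) rho0.
  rewrite -/(f k.+1) (fm k) ?(fm k.+1) ?graph_ball_uniq //; last 2 first.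
  - exact: sub_graph_ballS.
  - by move=> x /sub_graph_ballS /sub_graph_ballS.
  move=> /le_trans; apply; rewrite mulnS exprD -mulrA ler_wpM2l // ?sqr_ge0 //.
have := massn n.
have oB : o \in graph_ball o n by elim: n => [|n IH]; [rewrite inE|exact: sub_graph_ballS].
rewrite (bigD1_seq o) ?graph_ball_uniq //= => h.
have {h} : deg o * f n o ^+ 2 <= rho ^+ (2 * n) * deg o.
  apply: le_trans h; rewrite lerDl; apply: sumr_ge0 => x _.
  by rewrite mulr_ge0 ?sqr_ge0 // ltW.
rewrite mulrC ler_pM2r // mulnC exprM ler_pXn2r // ?nnegrE ?exprn_ge0 //; exact: ltW.
Qed.

End SpectralGap.

(** * Histories *)

(* A history lists the positions of the jump chain, the latest one first. *)
Section Histories.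
Variables (R : realType) (V : choiceType) (nb : V -> seq V) (o : V) (a : R).
Implicit Types (s : seq V) (j : V).

Fixpoint histories n : seq (seq V) :=
  if n is m.+1 then [seq j :: s | s <- histories m, j <- nb (head o s)]
  else [:: [:: o]].

Fixpoint history_edges s : seq {fset V} :=
  if s is j :: s' then
    if s' is i :: _ then [fset i; j]%fset :: history_edges s' else [::]
  else [::].

Definition known s j := [fset head o s; j]%fset \in history_edges s.

Definition rate s j : R := if known s j then 1 else a.

Definition total_rate s : R := \sum_(j <- nb (head o s)) rate s j.

(** For exponential clocks this is E[e^(eta tau_n); the jump chain starts with s], and for [eta = 0]
    the probability that the jump chain starts with [s]. *)
Fixpoint weight (eta : R) s : R :=
  if s is j :: s' then
    if s' is _ :: _ then weight eta s' * (rate s' j / (total_rate s' - eta)) else 1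
  else 1.

Fixpoint srw_weight s : R :=
  if s is j :: s' then
    if s' is i :: _ then srw_weight s' / (size (nb i))%:R else 1
  else 1.

Definition frontier s := has (fun j => ~~ known s j) (nb (head o s)).

Fixpoint frontier_steps s : nat :=
  if s is j :: s' then
    if s' is _ :: _ then (frontier_steps s' + frontier s')%N else 0%N
  else 0%N.

Definition range_size s := size (undup (history_edges s)).

Lemma histories_neq0 n s : s \in histories n -> s <> [::].
Proof.
case: n => [|n] /=; first by rewrite inE => /eqP ->.
by move=> /allpairsPdep [s' [j [_ _ ->]]].
Qed.

Lemma sum_historiesS n (F : seq V -> R) :
  \sum_(s <- histories n.+1) F s =
  \sum_(s <- histories n) \sum_(j <- nb (head o s)) F (j :: s).
Proof. by rewrite /= big_allpairs_dep. Qed.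

Lemma weight_cons eta j s : s <> [::] ->
  weight eta (j :: s) = weight eta s * (rate s j / (total_rate s - eta)).
Proof. by case: s. Qed.

Lemma srw_weight_cons j s : s <> [::] ->
  srw_weight (j :: s) = srw_weight s / (size (nb (head o s)))%:R.
Proof. by case: s. Qed.

Lemma frontier_steps_cons j s : s <> [::] ->
  frontier_steps (j :: s) = (frontier_steps s + frontier s)%N.
Proof. by case: s. Qed.

Lemma range_size_cons j s : s <> [::] ->
  range_size (j :: s) = (range_size s + ~~ known s j)%N.
Proof.
case: s => // i s _; rewrite /range_size /known /=.
by case: ifP => _ /=; rewrite ?addn0 ?addn1.
Qed.

Lemma frontier_steps_le n s : s \in histories n -> (frontier_steps s <= n)%N.
Proof.
elim: n s => [|n IH] s /=; first by rewrite inE => /eqP ->.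
move=> /allpairsPdep [s' [j [s'n _ ->]]].
rewrite frontier_steps_cons; last exact: histories_neq0 s'n.
by have := IH _ s'n; case: frontier; lia.
Qed.

(** A supermartingale estimate in finite form: a bound on one extension step is iterated [n]
    times. *)
Lemma sum_histories_le (w : seq V -> R) (c : R) n : 0 <= c ->
  (forall m s, s \in histories m -> \sum_(j <- nb (head o s)) w (j :: s) <= c * w s) ->
  \sum_(s <- histories n) w s <= c ^+ n * w [:: o].
Proof.
move=> c0 step; elim: n => [|n IH]; first by rewrite /= big_seq1 mul1r.
rewrite sum_historiesS exprS -mulrA; apply: le_trans (ler_wpM2l c0 IH).
rewrite mulr_sumr big_seq [leRHS]big_seq; apply: ler_sum => s; exact: step.
Qed.

(** Histories grow at their latest step, so that step is absorbed into the test function; this is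
    why [f] is general in the induction. *)
Lemma sum_srw_weight n (f : V -> R) :
  \sum_(s <- histories n) srw_weight s * f (head o s) = iter n (srw nb) f o.
Proof.
elim: n f => [|n IH] f; first by rewrite /= big_seq1 mul1r.
rewrite sum_historiesS iterSr -IH; apply: eq_big_seq => s sn.
rewrite /srw mulrA mulrAC mulr_sumr; apply: eq_bigr => j _.
by rewrite (srw_weight_cons j (histories_neq0 sn)).
Qed.

Hypothesis nb_nonempty : forall x, (0 < size (nb x))%N.
Hypothesis a01 : 0 < a < 1.

Lemma rate_ge s j : a <= rate s j.
Proof. by rewrite /rate; case: ifP => _ //; case/andP: a01 => _ /ltW. Qed.

Lemma rate_le1 s j : rate s j <= 1.
Proof. by rewrite /rate; case: ifP => _ //; case/andP: a01 => _ /ltW. Qed.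

Lemma rate_gt0 s j : 0 < rate s j.
Proof. by apply: lt_le_trans (rate_ge _ _); case/andP: a01. Qed.

Lemma total_rate_ge_deg s : a * (size (nb (head o s)))%:R <= total_rate s.
Proof.
rewrite -sum1_size natr_sum mulr_sumr; apply: ler_sum => j _.
by rewrite mulr1 rate_ge.
Qed.

Lemma total_rate_le_deg s : total_rate s <= (size (nb (head o s)))%:R.
Proof. by rewrite -sum1_size natr_sum; apply: ler_sum => j _; exact: rate_le1. Qed.

Lemma total_rate_ge s : a <= total_rate s.
Proof.
apply: le_trans (total_rate_ge_deg s); case/andP: a01 => a0 _.
by rewrite ler_pMr // ler1n.
Qed.

Lemma total_rate_gt0 s : 0 < total_rate s.
Proof. by apply: lt_le_trans (total_rate_ge _); case/andP: a01. Qed.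

Lemma weight_ge0 eta s : eta < a -> 0 <= weight eta s.
Proof.
move=> eta_a; elim: s => // j [|i s] // IH.
rewrite weight_cons // mulr_ge0 // divr_ge0 //; first exact/ltW/rate_gt0.
by rewrite subr_ge0 (le_trans _ (total_rate_ge _)) // ltW.
Qed.

Lemma weight_le_srw n s : s \in histories n ->
  a ^+ frontier_steps s * weight 0 s <= srw_weight s.
Proof.
case/andP: (a01) => a0 a1.
elim: n s => [|n IH] s /=; first by rewrite inE => /eqP -> /=; rewrite mulr1.
move=> /allpairsPdep [s' [j [s'n js ->]]]; have s'0 := histories_neq0 s'n.
rewrite frontier_steps_cons // weight_cons // srw_weight_cons // subr0.
rewrite exprD mulrACA; apply: ler_pM; rewrite ?IH //.
- by rewrite mulr_ge0 ?exprn_ge0 ?weight_ge0 // ltW.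
- by rewrite mulr_ge0 ?exprn_ge0 ?divr_ge0 // ltW ?rate_gt0 ?total_rate_gt0.
have d0 : 0 < (size (nb (head o s')))%:R :> R by rewrite ltr0n.
rewrite mulrA ler_pdivrMr ?total_rate_gt0 // [leRHS]mulrC ler_pdivlMr //.
have [fr|/hasPn nfr] := boolP (frontier s').
  rewrite expr1; apply: le_trans (total_rate_ge_deg s').
  by rewrite ler_pM2r // ler_piMr ?rate_le1 // ltW.
have rate1 i : i \in nb (head o s') -> rate s' i = 1.
  by move=> /nfr; rewrite negbK /rate => ->.
rewrite expr0 mul1r rate1 // mul1r /total_rate (eq_big_seq _ rate1).
by rewrite -sum1_size natr_sum.
Qed.

(** The total rate R is at least [a], so each step contributes R / (R - a / 2) <= 2. *)
Lemma sum_weight_half n : \sum_(s <- histories n) weight (a / 2) s <= 2 ^+ n.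
Proof.
case/andP: (a01) => a0 a1.
have := @sum_histories_le (weight (a / 2)) 2 n _ _; rewrite mulr1; apply => // m s sm.
have s0 := histories_neq0 sm; under eq_bigr => j _ do rewrite weight_cons //.
rewrite -mulr_sumr mulrC ler_wpM2r ?weight_ge0 //; first by rewrite ltr_pdivrMr //; lra.
have ge := total_rate_ge s; rewrite -mulr_suml -/(total_rate s) ler_pdivrMr; lra.
Qed.

Variable D : nat.
Hypothesis nb_size : forall x, (size (nb x) <= D)%N.
(** If a new edge is used with probability p >= a / D, then the mean of 2^(-1) to the number of new
    edges is 1 - p / 2, at most [x^-1]. Hence [x] to the number of frontier steps, times 2 to the
    power minus the range, does not grow in mean. *)
Let x := (1 - a / (2 * D%:R))^-1.

Lemma D_gt0 : 0 < D%:R :> R.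
Proof. by rewrite ltr0n; apply: leq_trans (nb_size o). Qed.

Lemma growth_bounds : 0 < a / (2 * D%:R) < 1.
Proof.
case/andP: (a01) => a0 a1; have D0 := D_gt0.
have D1 : 1 <= D%:R :> R by move: D0; rewrite ltr0n ler1n.
by rewrite divr_gt0 ?mulr_gt0 //= ltr_pdivrMr ?mulr_gt0 // mul1r; lra.
Qed.

(* From a vertex with an untraversed edge, a new edge is used with probability
   at least [a / D]. *)
Lemma sum_weight_frontier n :
  \sum_(s <- histories n) weight 0 s * (x ^+ frontier_steps s * 2^-1 ^+ range_size s) <= 1.
Proof.
case/andP: (a01) => a0 a1; have D0 := D_gt0.
have := growth_bounds; set y := a / _ => /andP[y0 y1].
pose w s := weight 0 s * (x ^+ frontier_steps s * 2^-1 ^+ range_size s).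
have := @sum_histories_le w 1 n _ _; rewrite expr1n mul1r /w /= !mulr1; apply => // m s sm.
have s0 := histories_neq0 sm; rewrite mul1r.
have x0 : 0 < x by rewrite invr_gt0 subr_gt0.
have t0 := total_rate_gt0 s.
have E j : weight 0 (j :: s) * (x ^+ frontier_steps (j :: s) * 2^-1 ^+ range_size (j :: s))
  = weight 0 s * (x ^+ frontier_steps s * 2^-1 ^+ range_size s) *
    (x ^+ frontier s * (rate s j * 2^-1 ^+ (~~ known s j)) / total_rate s).
  rewrite weight_cons // frontier_steps_cons // range_size_cons // !exprD subr0.
  by move: (weight 0 s) (rate s j) (total_rate s)^-1 (x ^+ _) (x ^+ _) (2^-1 ^+ _) (2^-1 ^+ _) => *; ring.
under eq_bigr => j _ do rewrite E.
rewrite -mulr_sumr ler_piMr //.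
  by rewrite mulr_ge0 ?weight_ge0 // mulr_ge0 // exprn_ge0 // ltW.
rewrite -mulr_suml ler_pdivrMr // mul1r -mulr_sumr.
have [fr|/hasPn nfr] := boolP (frontier s); last first.
  rewrite expr0 mul1r /total_rate big_seq [leRHS]big_seq; apply: ler_sum => j /nfr.
  by rewrite negbK => ->; rewrite mulr1.
rewrite expr1 /x mulrC ler_pdivrMr ?subr_gt0 //.
have [j0 j0s j0new] := hasP fr.
(* The untraversed edge to [j0] alone accounts for the gain: its rate [a] is halved, and no other
   term increases. *)
have H : \sum_(j <- nb (head o s)) rate s j * 2^-1 ^+ (~~ known s j) + a / 2 <= total_rate s.
  rewrite /total_rate (big_rem j0) // [leRHS](big_rem j0) //= addrAC lerD //.
    by rewrite j0new /rate (negbTE j0new) expr1; lra.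
  apply: ler_sum => j _; rewrite ler_piMr //; first exact/ltW/rate_gt0.
  by rewrite exprn_ile1 //; lra.
apply: le_trans (_ : total_rate s - a / 2 <= _); first by rewrite lerBrDr.
rewrite mulrBr mulr1 lerB // (_ : a / 2 = D%:R * y); last first.
  by rewrite /y; field; exact: lt0r_neq0.
rewrite ler_pM2r //; apply: le_trans (total_rate_le_deg s) _.
by rewrite ler_nat nb_size.
Qed.

Section Return.
Variable rho : R.
Hypothesis rho01 : 0 < rho < 1.
Hypothesis srw_return_le : forall n, iter n (srw nb) (dirac_at R o) o <= rho ^+ n.

Lemma sum_weight_return n :
  \sum_(s <- histories n | head o s == o) a ^+ frontier_steps s * weight 0 s <= rho ^+ n.
Proof.
apply: le_trans (srw_return_le n); rewrite -sum_srw_weight big_mkcond.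
rewrite big_seq [leRHS]big_seq; apply: ler_sum => s sn; rewrite /dirac_at.
by case: eqP => _; rewrite ?mulr0 // mulr1; exact: weight_le_srw sn.
Qed.

Lemma sum_weight_return_le n :
  \sum_(s <- histories n | head o s == o) weight 0 s <= (rho / a) ^+ n.
Proof.
case/andP: (a01) => a0 a1.
rewrite expr_div_n ler_pdivlMr ?exprn_gt0 // mulrC.
apply: le_trans (sum_weight_return n); rewrite mulr_sumr.
rewrite big_seq_cond [leRHS]big_seq_cond; apply: ler_sum => s /andP[sn _].
rewrite ler_wpM2r ?weight_ge0 // ler_wiXn2l ?(ltW a0) ?(ltW a1) //.
exact: frontier_steps_le.
Qed.

Lemma sum_weight_return_small_range : exists eps beta : R, [/\ 0 < eps, 0 < beta &
  forall n, \sum_(s <- histories n | (head o s == o) && ((range_size s)%:R <= eps * n%:R))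
     weight 0 s <= 2 * expR (- beta * n%:R)].
Proof.
case/andP: (a01) => a0 a1; case/andP: (rho01) => r0 r1.
have [y0 y1] := andP growth_bounds; set y := a / _ in y0 y1.
have x1 : 1 < x by rewrite /x -/y invf_gt1 ?subr_gt0 //; lra.
have x0 : 0 < x by apply: lt_trans x1.
have lna : ln a < 0 by rewrite ln_lt0 // a0.
have lnr : ln rho < 0 by rewrite ln_lt0 // r0.
have lnx : 0 < ln x by exact: ln_gt0.
have ln2 : 0 < ln 2 :> R by apply: ln_gt0; lra.
(* Chosen so that a^(-delta n) rho^n = rho^(n/2): up to delta n frontier steps cost only half of the
   exponential decay. *)
pose delta := ln rho / (2 * ln a).
have d0 : 0 < delta by rewrite /delta nmulr_rgt0 // invr_lt0; lra.
(* Chosen so that 2^(eps n) x^(-delta n) = x^(-delta n / 2). *)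
pose eps := ln x * delta / (2 * ln 2).
have e0 : 0 < eps by apply: divr_gt0; apply: mulr_gt0.
pose beta := Num.min (- ln rho / 2) (ln x * delta / 2).
have b0 : 0 < beta by rewrite lt_min; apply/andP; split; [lra|apply: divr_gt0 => //; exact: mulr_gt0].
exists eps, beta; split => // n.
have powE (u : R) k : 0 < u -> u ^+ k = expR (k%:R * ln u).
  by move=> u0; rewrite mulrC expRM_natr lnK.
(* Chernoff's argument in two cases: with at most delta n frontier steps the factor in the first
   term is at least 1; with more of them, and a small range, the factor in the second term is. *)
have split_le s : s \in histories n -> (range_size s)%:R <= eps * n%:R ->
   weight 0 s <= expR (- (ln a * delta * n%:R)) * (a ^+ frontier_steps s * weight 0 s)
     + expR (eps * n%:R * ln 2 - ln x * delta * n%:R)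
       * (weight 0 s * (x ^+ frontier_steps s * 2^-1 ^+ range_size s)).
  move=> sn Cs; have w0 : 0 <= weight 0 s by exact: weight_ge0.
  rewrite exprVn !powE // -expRN.
  rewrite mulrA (mulrCA _ (weight 0 s)) (mulrC _ (weight 0 s)) -mulrDr ler_peMr //.
  rewrite -!expRD.
  have [Ks|Ks] := leP (frontier_steps s)%:R (delta * n%:R).
    rewrite -[leLHS]addr0 lerD ?expR_ge0 // -[leLHS]expR0 ler_expR.
    rewrite (_ : _ + _ = - ln a * (delta * n%:R - (frontier_steps s)%:R)); last by ring.
    by rewrite mulr_ge0 ?subr_ge0 // oppr_ge0 ltW.
  rewrite -[leLHS]add0r lerD ?expR_ge0 // -[leLHS]expR0 ler_expR.
  rewrite [leRHS](_ : _ = ln x * ((frontier_steps s)%:R - delta * n%:R) +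
    ln 2 * (eps * n%:R - (range_size s)%:R)); last by ring.
  by rewrite addr_ge0 // mulr_ge0 ?subr_ge0 // ltW.
apply: (@le_trans _ _ (expR (- (ln a * delta * n%:R)) * rho ^+ n +
    expR (eps * n%:R * ln 2 - ln x * delta * n%:R))).
  apply: (@le_trans _ _ (\sum_(s <- histories n | head o s == o)
      expR (- (ln a * delta * n%:R)) * (a ^+ frontier_steps s * weight 0 s) +
    \sum_(s <- histories n) expR (eps * n%:R * ln 2 - ln x * delta * n%:R)
       * (weight 0 s * (x ^+ frontier_steps s * 2^-1 ^+ range_size s)))); last first.
    rewrite -!mulr_sumr lerD // ?ler_wpM2l ?expR_ge0 ?sum_weight_return //.
    by rewrite ler_piMr ?expR_ge0 ?sum_weight_frontier.
  rewrite big_mkcond [X in _ <= X + _]big_mkcond -big_split /=.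
  rewrite big_seq [leRHS]big_seq; apply: ler_sum => s sn.
  case: eqP => _ /=.
    case: ifP => [/split_le|_]; first exact.
    by rewrite addr_ge0 // ?mulr_ge0 ?expR_ge0 ?exprn_ge0 ?weight_ge0 // ltW.
  by rewrite add0r ?mulr_ge0 ?expR_ge0 ?exprn_ge0 ?weight_ge0 // ltW.
rewrite mulr2n mulrDl mul1r powE // -expRD; apply: lerD; rewrite ler_expR.
  rewrite (_ : _ + _ = - (- ln rho / 2) * n%:R); last first.
    by rewrite /delta; field; lra.
  by rewrite ler_wpM2r // lerN2 /beta ge_min lexx.
rewrite (_ : _ - _ = - (ln x * delta / 2) * n%:R); last first.
  by rewrite /eps; field; lra.
by rewrite ler_wpM2r // lerN2 /beta ge_min lexx orbT.
Qed.

End Return.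
End Histories.

(** * Jump times *)

Lemma counting_finite (R : realType) (T : choiceType) (s : seq T) :
  @counting T R [set` s] = (size (undup s))%:R%:E.
Proof.
have -> : [set` s] = [set` [fset z in s]%fset].
  by apply/seteqP; split => z /=; rewrite inE.
by rewrite /counting asboolT // set_fsetK card_fseq.
Qed.

Lemma counting_le (R : realType) (T : choiceType) (A B : set T) : A `<=` B ->
  (@counting T R A <= counting B)%E.
Proof.
move=> AB; rewrite /counting; case: asboolP => fA; case: asboolP => fB //=.
- by rewrite lee_fin ler_nat; apply: fsubset_leq_card; rewrite -fset_set_sub.
- by rewrite leey.
- by case: fA; apply: sub_finite_set fB.
Qed.

Section JumpTimes.
Variables (R : realType) (V : choiceType) (x : R -> V).
Hypothesis x_rc : right_continuous_path x.

Lemma right_constant t : 0 <= t -> exists2 d, 0 < d &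
  forall s, t <= s -> s < t + d -> x s = x t.
Proof.
move=> /x_rc; rewrite /at_right near_withinE.
move=> /nbhs_ballP [d /= d0 H]; exists d => // s.
rewrite le_eqVlt => /orP[/eqP -> //|ts sd]; apply: H => //.
by rewrite /ball /= ltr0_norm; lra.
Qed.

Lemma jump_timeS n s : jump_time x n = s%:E ->
  jump_time x n.+1 = ereal_inf [set t%:E | t in [set t | s < t /\ x t <> x s]].
Proof. by rewrite /= => ->. Qed.

Lemma jump_timeS_pinfty n : jump_time x n = +oo%E -> jump_time x n.+1 = +oo%E.
Proof. by rewrite /= => ->. Qed.

Local Arguments jump_time : simpl never.

Lemma jump_time_case n : jump_time x n = +oo%E \/
  exists2 s, 0 <= s & jump_time x n = s%:E.
Proof.
elim: n => [|n [IH|[s s0 IH]]]; first by right; exists 0.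
  by left; exact: jump_timeS_pinfty.
have : (s%:E <= jump_time x n.+1)%E.
  rewrite (jump_timeS IH); apply: le_ereal_inf_tmp => _ [t [/ltW st _] <-].
  by rewrite lee_fin.
case: (jump_time x n.+1) => [u|_|//]; last by left.
by rewrite lee_fin => su; right; exists u => //; exact: le_trans su.
Qed.

Lemma jump_time_fin n : (jump_time x n < +oo)%E ->
  jump_time x n = (fine (jump_time x n))%:E.
Proof. by case: (jump_time_case n) => [->|[s _ ->]]. Qed.

Lemma jump_time_ge0 n : (0 <= jump_time x n)%E.
Proof. by case: (jump_time_case n) => [->//|[s s0 ->]]; rewrite lee_fin. Qed.

Lemma jump_timeS_le n s t : jump_time x n = s%:E -> s < t -> x t <> x s ->
  (jump_time x n.+1 <= t%:E)%E.
Proof.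
by move=> ns st xt; rewrite (jump_timeS ns); apply: ereal_inf_lbound; exists t.
Qed.

Lemma jump_time_const n s t : jump_time x n = s%:E -> s <= t ->
  (t%:E < jump_time x n.+1)%E -> x t = x s.
Proof.
move=> ns; rewrite le_eqVlt => /orP[/eqP -> //|st] tn.
apply: contrapT => xt; move: tn; rewrite ltNge.
by rewrite (jump_timeS_le ns st xt).
Qed.

Lemma jump_timeS_gt n s : jump_time x n = s%:E -> (s%:E < jump_time x n.+1)%E.
Proof.
move=> ns; have s0 : 0 <= s by have := jump_time_ge0 n; rewrite ns lee_fin.
have [d d0 xd] := right_constant s0.
apply: (@lt_le_trans _ _ (s + d)%:E); first by rewrite lte_fin ltrDl.
rewrite (jump_timeS ns); apply: le_ereal_inf_tmp => _ [t [st xt] <-].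
by rewrite lee_fin leNgt; apply/negP => /(xd _ (ltW st)).
Qed.

Lemma jump_time_lt n : (jump_time x n < +oo)%E -> (jump_time x n < jump_time x n.+1)%E.
Proof. by move=> /jump_time_fin ns; rewrite {1}ns; exact: jump_timeS_gt. Qed.

Lemma jump_time_le m n : (m <= n)%N -> (jump_time x m <= jump_time x n)%E.
Proof.
move=> /subnK <-; elim: (n - m)%N => // k IH; apply: le_trans IH _.
have [E|[s _ E]] := jump_time_case (k + m).
  by rewrite E addSn jump_timeS_pinfty.
by rewrite E ltW // jump_timeS_gt.
Qed.

(** Right-continuity makes the infimum attained: if the path had its old value at [u], it would keep
    it for a while and the infimum would exceed [u]. *)
Lemma jump_value n s u : jump_time x n = s%:E -> jump_time x n.+1 = u%:E -> x u <> x s.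
Proof.
move=> ns nu xu; have su : s < u by have := jump_timeS_gt ns; rewrite nu lte_fin.
have u0 : 0 <= u by have := jump_time_ge0 n.+1; rewrite nu lee_fin.
have [d d0 xd] := right_constant u0.
have : ((u + d)%:E <= u%:E)%E.
  rewrite -[leRHS]nu (jump_timeS ns); apply: le_ereal_inf_tmp => _ [t [st xt] <-].
  rewrite lee_fin leNgt; apply/negP => tud.
  have [ut|tu] := leP u t; first by apply: xt; rewrite xd.
  by have := jump_timeS_le ns st xt; rewrite nu lee_fin leNgt tu.
by rewrite lee_fin leNgt ltrDl d0.
Qed.

Lemma skeletonE n s : jump_time x n = s%:E -> skeleton x n = x s.
Proof. by rewrite /skeleton => ->. Qed.

Lemma skeleton_eq n t : (jump_time x n <= t%:E)%E -> (t%:E < jump_time x n.+1)%E ->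
  x t = skeleton x n.
Proof.
move=> nt tn; have /jump_time_fin E : (jump_time x n < +oo)%E.
  by apply: le_lt_trans nt _; rewrite ltry.
by apply: jump_time_const tn => //; rewrite -lee_fin -E.
Qed.

Fixpoint history n : seq V :=
  if n is m.+1 then skeleton x n :: history m else [:: skeleton x 0].

Lemma head_history o n : head o (history n) = skeleton x n.
Proof. by case: n. Qed.

Lemma history_edgesE n :
  [set` history_edges (history n)] =
  [set [fset skeleton x m; skeleton x m.+1]%fset | m in [set m | (m < n)%N]].
Proof.
elim: n => [|n IH]; first by apply/seteqP; split => // A [].
have -> : history_edges (history n.+1) =
    [fset skeleton x n; skeleton x n.+1]%fset :: history_edges (history n).
  by case: n {IH}.
apply/seteqP; split => A /=.
  rewrite inE => /orP[/eqP ->|An]; first by exists n => /=.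
  have : [set` history_edges (history n)] A by [].
  by rewrite IH => -[m /= mn <-]; exists m => //=; rewrite ltnS ltnW.
move=> [m /=]; rewrite ltnS leq_eqVlt inE => /orP[/eqP -> <-|mn <-].
  by rewrite eqxx.
apply/orP; right.
have : [set` history_edges (history n)] [fset skeleton x m; skeleton x m.+1]%fset.
  by rewrite IH; exists m.
by [].
Qed.

Lemma traversed_history n t : (jump_time x n <= t%:E)%E ->
  [set` history_edges (history n)] `<=` traversed x t.
Proof.
move=> nt; rewrite history_edgesE => _ [m /= mn <-]; exists m => //=.
by apply: le_trans nt; exact: (@jump_time_le m.+1).
Qed.

Lemma traversed_eq n t : (jump_time x n <= t%:E)%E -> (t%:E < jump_time x n.+1)%E ->
  traversed x t = [set` history_edges (history n)].
Proof.
move=> nt tn; apply/seteqP; split; last exact: traversed_history.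
rewrite history_edgesE => _ [m /= mt <-]; exists m => //=.
rewrite ltnNge; apply/negP => nm.
have := le_lt_trans mt tn; rewrite ltNge => /negP; apply.
by apply: (@jump_time_le n.+1).
Qed.

(** Being reached is monotone in [t], so the increments of its probability give the law of the
    arrival time. Being [alive], defined next, is the event on which the jump rates are those of the
    history [s]. *)
Definition reached n s t := history n = s /\ (jump_time x n <= t%:E)%E.

Definition alive n s t := reached n s t /\ (t%:E < jump_time x n.+1)%E.

Lemma alive_pos (o : V) n s t : alive n s t -> x t = head o s.
Proof.
by move=> [[<- nt] tn]; rewrite head_history; exact: skeleton_eq.
Qed.

Lemma reached_le n s t u : t <= u -> reached n s t -> reached n s u.
Proof. by move=> tu [ns nt]; split => //; apply: le_trans nt _; rewrite lee_fin. Qed.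

Lemma reached_cons_history n j s t : reached n.+1 (j :: s) t -> reached n s t.
Proof.
by move=> [[_ ns] nt]; split => //; apply: le_trans nt; exact: jump_time_le.
Qed.

Lemma jump_rate_alive (a : R) (o : V) n s t j : alive n s t ->
  jump_rate a x t (head o s) j = rate o a s j.
Proof.
move=> [[<- nt] tn]; rewrite /jump_rate (traversed_eq nt tn) /rate /known.
by case: ifPn => [/asboolP /= ->//|/asboolP /= /negP/negbTE ->].
Qed.

Lemma aliveS (o : V) n s t t' : t <= t' -> alive n s t' ->
  ((alive n s t /\ x t' = head o s) \/ (reached n s t' /\ ~ reached n s t)).
Proof.
move=> tt' al; have [al' _] := al.
have [rt|rt] := pselect (reached n s t); last by right.
left; split; last exact: alive_pos al.
by split => //; apply: le_lt_trans al.2; rewrite lee_fin.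
Qed.

(** If exactly one jump falls between [t] and [t'], the old history is alive at [t] and the new
    vertex is still occupied at [t']. The margin [t' < u] is there because [two_jumps] refers to an
    open interval, while a jump may occur at [t'] itself. *)
Lemma reachedS_or_two_jumps (o : V) n j s t t' u :
  t < t' -> t' < u -> reached n.+1 (j :: s) t' -> ~ reached n.+1 (j :: s) t ->
  (alive n s t /\ x t' = j) \/ two_jumps x t u.
Proof.
move=> tt' tu [[jE sE] nt'] nr; have tn : (t%:E < jump_time x n.+1)%E.
  by rewrite ltNge; apply/negP => nt; apply: nr; split=> //=; rewrite jE sE.
have t'u : (t'%:E < u%:E)%E by rewrite lte_fin.
have [nt|nt] := leP (jump_time x n) t%:E; last first.
  by right; exists n; split => //; exact: le_lt_trans t'u.
have [n't|n't] := leP (jump_time x n.+2) t'%:E.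
  by right; exists n.+1; split => //; exact: le_lt_trans t'u.
left; split; first by split.
by rewrite (skeleton_eq nt' n't).
Qed.

(* The rationals together with [t]: dense in [[0, t]] and, unlike the rationals
   alone, sufficient to see a jump at time [t] itself. *)
Definition grid (t : R) (q : option rat) : R := if q is Some r then ratr r else t.

(** Describes the arrival by values of the path at countably many times up to [t], which is what
    makes it an event of the past of [t]. *)
Lemma reachedSP (o : V) n j s t : j <> head o s ->
  reached n.+1 (j :: s) t <->
  exists q, [/\ 0 <= grid t q <= t, reached n s (grid t q), x (grid t q) = j &
    forall q', 0 <= grid t q' <= t -> grid t q' < grid t q ->
      reached n s (grid t q') -> x (grid t q') = head o s \/ x (grid t q') = j].
Proof.
move=> js; split.
  move=> re; have [[jE sE] nt] := re.
  have [E|[u u0 E]] := jump_time_case n.+1; first by move: nt; rewrite E.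
  have ut : u <= t by move: nt; rewrite E lee_fin.
  have xu : x u = j by rewrite -(skeletonE E).
  have nu : reached n s u.
    by apply: (@reached_cons_history _ j); split; rewrite /= ?jE ?sE // -/(jump_time x n.+1) E.
  have [d d0 xd] := right_constant u0.
  have before q' : q' < u + d -> reached n s q' -> x q' = head o s \/ x q' = j.
    move=> q'd [_ nq']; have [uq'|q'u] := leP u q'; first by right; rewrite xd.
    left; rewrite -sE head_history; apply: skeleton_eq => //.
    by rewrite E lte_fin.
  have [ut'|tu] := ltP u t; last first.
    have tE : t = u by apply/eqP; rewrite eq_le ut tu.
    exists None => /=; rewrite tE u0 lexx; split => // q' _ q'u.
    by apply: before; apply: lt_le_trans q'u _; rewrite lerDl ltW.
  have [q] : exists q, ratr q \in `]u, Num.min t (u + d)[.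
    by apply: rat_in_itvoo; rewrite lt_min ut' ltrDl d0.
  rewrite in_itv /= lt_min => /and3P[uq qt qd].
  exists (Some q) => /=; split.
  - by rewrite (ltW qt) (le_trans u0) // ltW.
  - exact: reached_le (ltW uq) nu.
  - by rewrite xd // ltW.
  - by move=> q' _ q'q; apply: before; exact: lt_trans qd.
move=> [q []]; set v := grid t q => /andP[v0 vt] [ns nv] xv before.
have [E|[w w0 E]] := jump_time_case n; first by move: nv; rewrite E.
have xw : x w = head o s by rewrite -(skeletonE E) -ns head_history.
have wv : w < v.
  rewrite lt_neqAle -lee_fin -E nv andbT; apply/eqP => wv.
  by apply: js; rewrite -xv -wv.
have nv' : (jump_time x n.+1 <= v%:E)%E.
  by apply: jump_timeS_le E wv _; rewrite xw xv.
split; last by apply: le_trans nv' _; rewrite lee_fin.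
rewrite -ns; congr (_ :: _).
have [E'|[u u0 E']] := jump_time_case n.+1; first by move: nv'; rewrite E'.
rewrite (skeletonE E'); have uv : u <= v by move: nv'; rewrite E' lee_fin.
have xu : x u <> head o s by rewrite -xw; exact: jump_value E E'.
have [//|uv'] : u = v \/ u < v.
  by move: uv; rewrite le_eqVlt => /orP[/eqP|]; [left|right].
  by move=> ->.
(* A jump at [u] to a vertex other than [j] would remain visible at some rational time between [u]
   and [v], against [before]. *)
have [d d0 xd] := right_constant u0.
have [r] : exists r, ratr r \in `]u, Num.min v (u + d)[.
  by apply: rat_in_itvoo; rewrite lt_min uv' ltrDl d0.
rewrite in_itv /= lt_min => /and3P[ur rv rd].
have nu : reached n s u by split => //; rewrite -E'; exact: jump_time_le.
have := before (Some r); rewrite /= xd ?(ltW ur) // => H.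
case: H => //.
- by rewrite (le_trans u0 (ltW ur)) (le_trans (ltW rv) vt).
- exact: reached_le (ltW ur) nu.
Qed.

Section NearestNeighbour.
Variables (e : rel V) (nb : V -> seq V) (o : V).
Hypothesis nbE : forall x y, (y \in nb x) = e x y.
Hypothesis x_nn : nearest_neighbour_path e x.
Hypothesis x0 : x 0 = o.

Lemma history_histories n : (jump_time x n < +oo)%E -> history n \in histories nb o n.
Proof.
elim: n => [_|n IH nS]; first by rewrite /= /skeleton /= x0 inE.
apply/allpairsPdep; exists (history n), (skeleton x n.+1); split => //.
  by apply: IH; apply: le_lt_trans nS; exact: jump_time_le.
by rewrite head_history nbE; exact: x_nn.
Qed.

Lemma reachedS_next n s t : history n = s -> (jump_time x n.+1 <= t%:E)%E ->
  exists2 j, j \in nb (head o s) & reached n.+1 (j :: s) t.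
Proof.
move=> ns nt; exists (skeleton x n.+1); last by split; rewrite //= ns.
by rewrite -ns head_history nbE; apply: x_nn; apply: le_lt_trans nt _; rewrite ltry.
Qed.

(** Trades the condition on the next jump time for finitely many events [reached], one for each
    neighbour. *)
Lemma aliveP n s t : alive n s t <->
  reached n s t /\ ~ exists2 j, j \in nb (head o s) & reached n.+1 (j :: s) t.
Proof.
split=> [[re tn]|[re nex]]; split => //.
  by move=> [j _ [_]]; rewrite leNgt tn.
rewrite ltNge; apply/negP => nt; apply: nex; exact: reachedS_next re.1 nt.
Qed.

Lemma traversed_seq t (F : seq {fset V}) : 0 <= t ->
  (forall A, A \in F -> traversed x t A) ->
  exists2 n, (jump_time x n <= t%:E)%E & {subset F <= history_edges (history n)}.
Proof.
move=> t0; elim: F => [|A F IH] AF; first by exists 0%N; rewrite // lee_fin.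
have [B BF|n nt Fn] := IH; first by apply: AF; rewrite inE BF orbT.
have [m mt mA] := AF A (mem_head _ _).
exists (maxn n m.+1); first by rewrite /maxn; case: ifP.
have sub p : (p <= maxn n m.+1)%N ->
    {subset history_edges (history p) <= history_edges (history (maxn n m.+1))}.
  move=> pmax B; have : [set` history_edges (history p)] `<=`
      [set` history_edges (history (maxn n m.+1))].
    rewrite !history_edgesE => _ [l lp <-]; exists l => //=.
    exact: leq_trans pmax.
  by apply.
move=> B; rewrite inE => /orP[/eqP ->|/Fn]; last by apply: sub; exact: leq_maxl.
apply: (sub m.+1); first exact: leq_maxr.
have : [set` history_edges (history m.+1)] A by rewrite history_edgesE; exists m => /=.
by [].
Qed.

(** On a path whose jump times accumulate, the traversed set may be infinite. Strict lower bounds on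
    its size are still witnessed by a finite set of edges, hence by one reached history. *)
Lemma traversed_counting_gt t (k : R) : 0 <= t ->
  (k%:E < @counting _ R (traversed x t))%E <->
  exists n s, [/\ s \in histories nb o n, reached n s t & k < (range_size s)%:R].
Proof.
move=> t0; split; last first.
  move=> [n [s [_ [<- nt] ks]]].
  apply: (@lt_le_trans _ _ (range_size (history n))%:R%:E); first by rewrite lte_fin.
  by rewrite -counting_finite; apply: counting_le; exact: traversed_history.
move=> kt.
have [F Ft kF] : exists2 F : {fset {fset V}}, [set` F] `<=` traversed x t & k < #|` F|%:R.
  move: kt; rewrite /counting; case: asboolP => [fin|inf] kt.
    by exists (fset_set (traversed x t)); rewrite ?fset_setK // -lte_fin.
  have [F Ft Fk] := infinite_set_fset (Num.bound `|k|) inf; exists F => //.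
  apply: (le_lt_trans (ler_norm k)); apply: lt_le_trans (archi_boundP (normr_ge0 k)) _.
  by rewrite ler_nat.
have [n nt Fn] := traversed_seq t0 Ft.
exists n, (history n); split => //.
  by apply: history_histories; apply: le_lt_trans nt _; rewrite ltry.
apply: lt_le_trans kF _; rewrite ler_nat /range_size.
by apply: uniq_leq_size => // A /Fn; rewrite mem_undup.
Qed.

End NearestNeighbour.
End JumpTimes.

(** * Measurability *)

Section SigmaAlgebra.
Variables (T : Type) (S : set (set T)).
Hypothesis S_sigma : sigma_algebra setT S.
Implicit Types A B : set T.

Lemma sigmaC A : S A -> S (~` A).
Proof. by case: S_sigma => _ SD _ /SD; rewrite setTD. Qed.

Lemma sigma0 : S set0. Proof. by case: S_sigma. Qed.

Lemma sigmaT : S setT. Proof. by rewrite -setC0; apply: sigmaC; exact: sigma0. Qed.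

Lemma sigma_countable (U : countType) (A : U -> set T) :
  (forall u, S (A u)) -> S [set w | exists u, A u w].
Proof.
move=> SA; case: S_sigma => S0 _ /(_ (fun n => oapp A set0 (choice.unpickle n))) SU.
rewrite (_ : mkset _ = \bigcup_n oapp A set0 (choice.unpickle n)).
  by apply: SU => n; case: choice.unpickle => [u|] //=; exact: SA.
apply/seteqP; split => w /=; first by move=> [u Au]; exists (choice.pickle u) => //; rewrite choice.pickleK.
by move=> [n _]; case: choice.unpickle => //= u Au; exists u.
Qed.

Lemma sigma_countableI (U : countType) (A : U -> set T) :
  (forall u, S (A u)) -> S [set w | forall u, A u w].
Proof.
move=> SA; rewrite (_ : mkset _ = ~` [set w | exists u, (~` A u) w]).
  by apply: sigmaC; apply: sigma_countable => u; exact: sigmaC.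
apply/seteqP; split => w /=; first by move=> Aw [u]; apply; exact: Aw.
by move=> Aw u; apply: contrapT => Au; apply: Aw; exists u.
Qed.

Lemma sigmaU A B : S A -> S B -> S (A `|` B).
Proof.
move=> SA SB; rewrite (_ : _ `|` _ = [set w | exists b : bool, (if b then A else B) w]).
  by apply: sigma_countable => -[].
apply/seteqP; split => w /=; first by case=> [Aw|Bw]; [exists true|exists false].
by move=> [[] /= ?]; [left|right].
Qed.

Lemma sigmaI A B : S A -> S B -> S (A `&` B).
Proof.
by move=> SA SB; rewrite -[X in S X]setCK setCI; apply/sigmaC/sigmaU; exact: sigmaC.
Qed.

Lemma sigmaD A B : S A -> S B -> S (A `\` B).
Proof. by move=> SA SB; rewrite setDE; apply: sigmaI => //; exact: sigmaC. Qed.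

Lemma sigma_const (p : Prop) : S [set _ | p].
Proof.
have [pT|pF] := pselect p.
  by rewrite (_ : mkset _ = setT) ?predeqE //; exact: sigmaT.
by rewrite (_ : mkset _ = set0) ?predeqE //; exact: sigma0.
Qed.

Lemma sigma_seq (I : eqType) (l : seq I) (A : I -> set T) :
  (forall i, i \in l -> S (A i)) -> S [set w | exists2 i, i \in l & A i w].
Proof.
elim: l => [|i l IH] SA.
  by rewrite (_ : mkset _ = set0) ?predeqE; [exact: sigma0|move=> w; split => // -[]].
rewrite (_ : mkset _ = A i `|` [set w | exists2 i, i \in l & A i w]).
  by apply: sigmaU; [apply: SA; rewrite inE eqxx|apply: IH => k kl; apply: SA; rewrite inE kl orbT].
apply/seteqP; split => w /=.
  move=> [k]; rewrite inE => /orP[/eqP ->|kl] Ak; [by left|by right; exists k].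
by case=> [Ai|[k kl Ak]]; [exists i|exists k]; rewrite // inE ?eqxx ?kl ?orbT.
Qed.

End SigmaAlgebra.

Section Filtration.
Variables (R : realType) (d : measure_display) (T : measurableType d).
Variables (V : choiceType) (e : rel V) (nb : V -> seq V) (o : V) (X : T -> R -> V).
Hypothesis e_irr : irreflexive e.
Hypothesis nbE : forall x y, (y \in nb x) = e x y.
Hypothesis X_measurable : forall t v, 0 <= t -> measurable [set w | X w t = v].
Hypothesis X_path : forall w,
  [/\ X w 0 = o, right_continuous_path (X w) & nearest_neighbour_path e (X w)].

Let F := natural_filtration X.

Lemma filtration_sigma t : sigma_algebra setT (F t).
Proof. exact: smallest_sigma_algebra. Qed.

Lemma filtration_measurable t A : 0 <= t -> F t A -> measurable A.
Proof.
move=> t0; apply: smallest_sub; first exact: sigma_algebra_measurable.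
by move=> _ [s [v [/andP[s0 _] ->]]]; exact: X_measurable.
Qed.

Lemma filtration_le s t : s <= t -> F s `<=` F t.
Proof.
move=> st; apply: sub_sigma_algebra2 => _ [u [v [/andP[u0 us] ->]]].
by exists u, v; rewrite u0 (le_trans us).
Qed.

Lemma filtration_value s t v : 0 <= s <= t -> F t [set w | X w s = v].
Proof. by move=> st; apply: sub_sigma_algebra; exists s, v. Qed.

(** The rates are conditional on the past, and the defining integral identity of [is_cond_prob]
    holds only over events of the filtration; ambient measurability would not be enough. *)
Lemma reached_filtration n s t : 0 <= t -> s \in histories nb o n ->
  F t [set w | reached (X w) n s t].
Proof.
elim: n s t => [|n IH] s t t0.
  rewrite inE => /eqP ->; rewrite (_ : mkset _ = setT); first exact: sigmaT (filtration_sigma t).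
  apply/seteqP; split => w // _; have [X0 _ _] := X_path w.
  by split; rewrite /= /skeleton /= ?X0 ?lee_fin.
move=> /allpairsPdep [s' [j [s'n js' ->]]].
have js : j <> head o s' by move=> jE; move: js'; rewrite nbE jE e_irr.
have S := filtration_sigma t.
have Fr q : 0 <= q <= t -> F t [set w | reached (X w) n s' q].
  by move=> /andP[q0 qt]; apply: (filtration_le qt); exact: IH.
rewrite (_ : mkset _ = [set w | exists q : option rat,
    [set w | [/\ 0 <= grid t q <= t, reached (X w) n s' (grid t q), X w (grid t q) = j &
    forall q', 0 <= grid t q' <= t -> grid t q' < grid t q ->
      reached (X w) n s' (grid t q') ->
      X w (grid t q') = head o s' \/ X w (grid t q') = j]] w]); last first.
  apply/seteqP; split => w; have [_ rc _] := X_path w; by move/(reachedSP rc n t js).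
apply: (sigma_countable S) => q.
have [qt|qt] := boolP (0 <= grid t q <= t); last first.
  rewrite (_ : mkset _ = set0); first exact: sigma0 S.
  by apply/seteqP; split => w // -[].
rewrite (_ : mkset _ = [set w | reached (X w) n s' (grid t q)] `&`
   [set w | X w (grid t q) = j] `&` [set w | forall q', [set w |
      0 <= grid t q' <= t -> grid t q' < grid t q ->
      reached (X w) n s' (grid t q') ->
      X w (grid t q') = head o s' \/ X w (grid t q') = j] w]); last first.
  by apply/seteqP; split => w /=; [move=> []|move=> [[]]].
apply: (sigmaI S); first by apply: (sigmaI S); [exact: Fr|exact: filtration_value].
apply: (sigma_countableI S) => q'.
have [q't|q't] := boolP (0 <= grid t q' <= t); last first.
  rewrite (_ : mkset _ = setT); first exact: sigmaT S.
  by apply/seteqP; split => w // _.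
have [q'q|q'q] := boolP (grid t q' < grid t q); last first.
  rewrite (_ : mkset _ = setT); first exact: sigmaT S.
  by apply/seteqP; split => w // _.
rewrite (_ : mkset _ = ~` [set w | reached (X w) n s' (grid t q')] `|`
   ([set w | X w (grid t q') = head o s'] `|` [set w | X w (grid t q') = j])).
  apply: (sigmaU S); first by apply: (sigmaC S); exact: Fr.
  by apply: (sigmaU S); exact: filtration_value.
apply/seteqP; split => w /=.
  move=> H; have [r|nr] := pselect (reached (X w) n s' (grid t q')); last by left.
  by right; exact: H.
by move=> [nr|H] _ _ // /nr.
Qed.

Lemma alive_filtration n s t : 0 <= t -> s \in histories nb o n ->
  F t [set w | alive (X w) n s t].
Proof.
move=> t0 sn; have S := filtration_sigma t.
rewrite (_ : mkset _ = [set w | reached (X w) n s t] `\`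
   [set w | exists2 j, j \in nb (head o s) & [set w | reached (X w) n.+1 (j :: s) t] w]).
  apply: (sigmaD S); first exact: reached_filtration.
  apply: (sigma_seq S) => j js; apply: reached_filtration => //.
  by apply/allpairsPdep; exists s, j.
by apply/seteqP; split => w; have [X0 rc nn] := X_path w; move/(aliveP o nbE nn).
Qed.

Let M := sigma_algebra_measurable T.

Lemma reached_measurable n s t : 0 <= t -> s \in histories nb o n ->
  measurable [set w | reached (X w) n s t].
Proof. by move=> t0 sn; apply: (filtration_measurable t0); exact: reached_filtration. Qed.

Lemma alive_measurable n s t : 0 <= t -> s \in histories nb o n ->
  measurable [set w | alive (X w) n s t].
Proof. by move=> t0 sn; apply: (filtration_measurable t0); exact: alive_filtration. Qed.

Lemma jump_time_le_measurable n t : measurable [set w | (jump_time (X w) n <= t%:E)%E].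
Proof.
have [t0|t0] := leP 0 t; last first.
  rewrite (_ : mkset _ = set0) //; apply/seteqP; split => w //= nt.
  have [_ rc _] := X_path w; have := jump_time_ge0 (X w) n.
  by move=> /le_trans/(_ nt); rewrite lee_fin leNgt t0.
rewrite (_ : mkset _ = [set w | exists2 s, s \in histories nb o n &
    [set w | reached (X w) n s t] w]).
  by apply: (sigma_seq M) => s sn; exact: reached_measurable.
apply/seteqP; split => w /=; last by move=> [s _ []].
move=> nt; have [X0 rc nn] := X_path w; exists (history (X w) n); last by [].
by apply: (history_histories rc nbE nn X0); apply: le_lt_trans nt _; rewrite ltry.
Qed.

Lemma jump_time_lt_measurable n t : measurable [set w | (jump_time (X w) n < t%:E)%E].
Proof.
rewrite (_ : mkset _ = [set w | exists q : rat, ([set w | (jump_time (X w) n <= (ratr q)%:E)%E] `&`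
    [set _ | ratr q < t]) w]).
  apply: (sigma_countable M) => q; apply: (sigmaI M).
    exact: jump_time_le_measurable.
  exact: sigma_const M _.
apply/seteqP; split => w /=; last first.
  by move=> [q [nq qt]]; apply: le_lt_trans nq _; rewrite lte_fin.
have [_ rc _] := X_path w; have [->//|[u u0 ->]] := jump_time_case (X w) n.
rewrite lte_fin => ut; have [q] := rat_in_itvoo ut.
by rewrite in_itv /= => /andP[uq qt]; exists q; rewrite lee_fin (ltW uq).
Qed.

Lemma two_jumps_measurable t u : measurable [set w | two_jumps (X w) t u].
Proof.
apply: (sigma_countable M) => n.
rewrite (_ : (fun _ => _) = ~` [set w | (jump_time (X w) n <= t%:E)%E] `&`
   [set w | (jump_time (X w) n.+1 < u%:E)%E]).
  apply: (sigmaI M); last exact: jump_time_lt_measurable.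
  by apply: (sigmaC M); exact: jump_time_le_measurable.
by apply/seteqP; split => w /= [tn nu]; split => //; move: tn; rewrite ltNge => /negP.
Qed.

(** Finiteness matters: after the last jump the skeleton reads the path at [fine +oo], which is 0,
    and would show spurious visits to [o]. *)
Definition arrived w n s := history (X w) n = s /\ (jump_time (X w) n < +oo)%E.

Lemma arrived_measurable n s : s \in histories nb o n -> measurable [set w | arrived w n s].
Proof.
move=> sn.
rewrite (_ : mkset _ = [set w | exists k : nat, [set w | reached (X w) n s k%:R] w]).
  by apply: (sigma_countable M) => k; exact: reached_measurable.
apply/seteqP; split => w /=; last first.
  by move=> [k [ns nk]]; split => //; apply: le_lt_trans nk _; rewrite ltry.
have [_ rc _] := X_path w; move=> [ns]; have [->//|[u u0 E]] := jump_time_case (X w) n.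
move=> _; exists (Num.bound u); split => //.
by rewrite E lee_fin ltW // archi_boundP.
Qed.

Lemma at_jumpE n v : [set w | at_jump (X w) n v] =
  [set w | exists2 s, s \in [seq s <- histories nb o n | head o s == v] & arrived w n s].
Proof.
apply/seteqP; split => w /=; have [X0 rc nn] := X_path w.
  move=> [nf nv]; exists (history (X w) n); last by [].
  by rewrite mem_filter head_history nv eqxx (history_histories rc nbE nn X0).
move=> [s]; rewrite mem_filter => /andP[/eqP hs _] [ns nf]; split => //.
by rewrite -hs -ns head_history.
Qed.

Lemma at_jump_measurable n v : measurable [set w | at_jump (X w) n v].
Proof.
rewrite at_jumpE; apply: (@sigma_seq _ _ M _ _ (fun s => [set w | arrived w n s])) => s.
by rewrite mem_filter => /andP[_]; exact: arrived_measurable.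
Qed.

End Filtration.

(** * Discretised Laplace transforms *)

Section DiscreteLaplace.
Variable R : realType.
Implicit Types (alpha beta g : nat -> R) (w h eta : R).

(** If [alpha k] is the probability that a random time is at most k h, this is a discretised
    E[e^(eta tau); tau <= K h], with the powers of [w] in the place of the exponential. *)
Definition laplace w alpha K : R :=
  alpha 0%N + \sum_(k < K) w ^+ k.+1 * (alpha k.+1 - alpha k).

Lemma laplaceS w alpha K :
  laplace w alpha K.+1 = laplace w alpha K + w ^+ K.+1 * (alpha K.+1 - alpha K).
Proof. by rewrite /laplace big_ord_recr /= addrA. Qed.

(* With [w = 1 / (1 - eta h)] the geometric sums produce exactly the factor
   [c / (tot - eta)], the Laplace transform of an exponential clock. *)
Lemma laplace_step alpha beta g h eta c tot e1 e2 K :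
  let w := (1 - eta * h)^-1 in
  0 < h -> 0 <= c -> 0 <= eta -> eta < tot -> eta * h < 1 -> 0 <= e1 -> 0 <= e2 ->
  (forall k, 0 <= g k) -> g 0%N <= alpha 0%N -> beta 0%N = 0 ->
  (forall k, g k.+1 <= (1 - tot * h) * g k + (alpha k.+1 - alpha k) + e1) ->
  (forall k, beta k.+1 - beta k <= h * c * g k + e2) ->
  laplace w beta K <=
    c / (tot - eta) * (laplace w alpha K + K%:R * w ^+ K * e1) + K%:R * w ^+ K * e2.
Proof.
move=> w h0 c0 eta0 eta_tot etah e10 e20 g0 g00 beta0 gS betaS.
have iw : w^-1 = 1 - eta * h by rewrite /w invrK.
have w0 : 0 < w by rewrite /w invr_gt0 subr_gt0.
have w1 : 1 <= w.
  rewrite /w invf_ge1 ?subr_gt0 // gerBl mulr_ge0 // ltW //.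
have sumw : \sum_(k < K) w ^+ k.+1 <= K%:R * w ^+ K.
  rewrite -[X in X%:R](card_ord K) -sum1_card natr_sum mulr_suml; apply: ler_sum => k _.
  by rewrite mul1r ler_weXn2l.
(* Up to the factor h, this discretises the integral of e^(eta t) P(alive at t). *)
pose U L := \sum_(k < L) w ^+ k * g k.
have UE L : U L.+1 <= w * (1 - tot * h) * U L + laplace w alpha L + \sum_(k < L) w ^+ k.+1 * e1.
  elim: L => [|L IH].
    by rewrite /U /laplace big_ord_recr !big_ord0 /= !add0r expr0 mul1r mulr0 add0r !addr0.
  rewrite /U big_ord_recr /= -/(U L.+1) laplaceS big_ord_recr /=.
  have -> : U L.+1 = U L + w ^+ L * g L by rewrite /U big_ord_recr.
  apply: (@le_trans _ _ (w * (1 - tot * h) * U L + laplace w alpha L +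
     \sum_(k < L) w ^+ k.+1 * e1 + w ^+ L.+1 * ((1 - tot * h) * g L + (alpha L.+1 - alpha L) + e1))).
    apply: lerD; last by rewrite ler_wpM2l ?exprn_ge0 // ltW.
    by apply: le_trans IH; rewrite /U big_ord_recr.
  by rewrite exprS le_eqVlt; apply/orP; left; apply/eqP; ring.
have U0 : 0 <= w ^+ K * g K by rewrite mulr_ge0 ?exprn_ge0 // ltW.
have UK : h * w * U K <= (laplace w alpha K + K%:R * w ^+ K * e1) / (tot - eta).
  rewrite ler_pdivlMr ?subr_gt0 //.
  have : U K * (1 - w * (1 - tot * h)) <= laplace w alpha K + K%:R * w ^+ K * e1.
    have := UE K; rewrite {1}/U big_ord_recr /= -/(U K) -mulr_suml => UK.
    have := ler_wpM2r e10 sumw; lra.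
  apply: le_trans; rewrite le_eqVlt; apply/orP; left; apply/eqP.
  (* The choice of [w] enters here: [w^-1 - (1 - tot * h)] equals [(tot - eta) * h]. *)
  have -> : 1 - w * (1 - tot * h) = w * (w^-1 - (1 - tot * h)) by field; exact: lt0r_neq0.
  by rewrite iw; ring.
rewrite {1}/laplace beta0 add0r.
apply: (@le_trans _ _ (\sum_(k < K) (c * (h * w) * (w ^+ k * g k) + w ^+ k.+1 * e2))).
  apply: ler_sum => k _.
  have := ler_wpM2l (exprn_ge0 k.+1 (ltW w0)) (betaS k); move/le_trans; apply.
  by rewrite exprS le_eqVlt; apply/orP; left; apply/eqP; ring.
rewrite big_split /= -mulr_sumr -mulr_suml -/(U K); apply: lerD; last exact: ler_wpM2r.
by rewrite -[leLHS]mulrA -[leRHS]mulrA ler_wpM2l // [leRHS]mulrC.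
Qed.

(** Markov's inequality: mass that arrives after [u] carries a factor of at least e^(eta u), because
    e^(eta h) <= w. *)
Lemma laplace_ge alpha h eta u A K :
  let w := (1 - eta * h)^-1 in
  0 < h -> 0 <= eta -> eta * h < 1 -> 0 <= A -> 0 <= alpha 0%N ->
  (forall k, alpha k <= alpha k.+1) ->
  (forall k, k%:R * h <= u -> alpha k <= A) ->
  expR (eta * u) * (alpha K - A) <= laplace w alpha K.
Proof.
move=> w h0 eta0 etah A0 a0 aS aA.
have w0 : 0 < w by rewrite /w invr_gt0 subr_gt0.
have lap0 L : 0 <= laplace w alpha L.
  rewrite addr_ge0 // sumr_ge0 // => k _.
  by rewrite mulr_ge0 ?subr_ge0 ?exprn_ge0 // ltW.
have neg L : L%:R * h <= u -> expR (eta * u) * (alpha L - A) <= laplace w alpha L.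
  move=> /aA Lu; apply: le_trans (lap0 L).
  by rewrite mulr_ge0_le0 ?expR_ge0 // subr_le0.
have ew : expR (eta * h) <= w.
  have := expR_ge1Dx (- (eta * h)); rewrite expRN => H.
  by rewrite -[leLHS]invrK /w lef_pV2 ?posrE ?invr_gt0 ?expR_gt0 ?subr_gt0.
elim: K => [|K IH].
  have [/neg //|u0] := leP (0%:R * h) u.
  rewrite /laplace big_ord0 addr0; rewrite mul0r in u0.
  have E1 : expR (eta * u) <= 1.
    by rewrite -[leRHS]expR0 ler_expR mulr_ge0_le0 // ltW.
  have [aA0|aA0] := leP (alpha 0%N) A.
    by apply: le_trans a0; rewrite mulr_ge0_le0 ?expR_ge0 // subr_le0.
  apply: (@le_trans _ _ (alpha 0%N - A)); last by rewrite gerBl.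
  by rewrite ler_piMl // subr_ge0 ltW.
have [/neg //|uK] := leP (K.+1%:R * h) u.
rewrite laplaceS (_ : alpha K.+1 - A = (alpha K - A) + (alpha K.+1 - alpha K)); last by ring.
rewrite mulrDr lerD // ler_wpM2r ?subr_ge0 //.
apply: (@le_trans _ _ (expR (eta * h) ^+ K.+1)); last first.
  by rewrite ler_pXn2r ?nnegrE ?expR_ge0 // ltW.
rewrite -expRM_natr ler_expR -mulrA ler_wpM2l // mulrC ltW //.
Qed.

End DiscreteLaplace.

(** * The jump chain and its jump times *)

Section RealProbability.
Variables (R : realType) (d : measure_display) (T : measurableType d).
Variable P : probability T R.
Implicit Types A B : set T.

Definition pr A : R := fine (P A).

Lemma prE A : measurable A -> P A = (pr A)%:E.
Proof. by move=> mA; rewrite /pr fineK // fin_num_measure. Qed.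

Lemma pr_ge0 A : 0 <= pr A.
Proof. by rewrite /pr fine_ge0. Qed.

Lemma pr_le A B : measurable A -> measurable B -> A `<=` B -> pr A <= pr B.
Proof.
by move=> mA mB AB; rewrite -lee_fin -!prE //; apply: le_measure; rewrite ?inE.
Qed.

Lemma prT : pr setT = 1.
Proof. by rewrite /pr probability_setT. Qed.

Lemma pr0 : pr set0 = 0.
Proof. by rewrite /pr measure0. Qed.

Lemma pr_disjointU A B : measurable A -> measurable B -> A `&` B = set0 ->
  pr (A `|` B) = pr A + pr B.
Proof.
move=> mA mB AB; apply: EFin_inj; rewrite EFinD -!prE //; last exact: measurableU.
exact: measureU.
Qed.

Lemma pr_split A B : measurable A -> measurable B -> pr A = pr (A `&` B) + pr (A `\` B).
Proof.
move=> mA mB; rewrite -pr_disjointU ?setUIDK //.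
- exact: measurableI.
- exact: measurableD.
- by rewrite setDE setIACA setICr setI0.
Qed.

Lemma pr_U_le A B : measurable A -> measurable B -> pr (A `|` B) <= pr A + pr B.
Proof.
move=> mA mB; rewrite -lee_fin EFinD -!prE //; last exact: measurableU.
exact: measureU2.
Qed.

Lemma pr_seq_le (I : eqType) (l : seq I) (A : I -> set T) :
  (forall i, i \in l -> measurable (A i)) ->
  pr [set w | exists2 i, i \in l & A i w] <= \sum_(i <- l) pr (A i).
Proof.
elim: l => [|i l IH] mA.
  by rewrite big_nil (_ : mkset _ = set0) ?pr0 // predeqE => w; split => // -[].
rewrite big_cons (_ : mkset _ = A i `|` [set w | exists2 i, i \in l & A i w]).
  have mA' k : k \in l -> measurable (A k) by move=> kl; apply: mA; rewrite inE kl orbT.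
  apply: le_trans (pr_U_le _ _) _; first by apply: mA; rewrite inE eqxx.
    exact: (sigma_seq (sigma_algebra_measurable T) mA').
  by rewrite lerD2l IH.
apply/seteqP; split => w /=.
  move=> [k]; rewrite inE => /orP[/eqP ->|kl] Ak; [by left|by right; exists k].
by case=> [Ai|[k kl Ak]]; [exists i|exists k]; rewrite // inE ?eqxx ?kl ?orbT.
Qed.

Lemma measurable_notin (V : eqType) (Z : T -> V) (l : seq V) :
  (forall v, measurable [set w | Z w = v]) -> measurable [set w | Z w \notin l].
Proof.
move=> mZ.
rewrite (_ : mkset _ = ~` [set w | exists2 v, v \in l & [set w | Z w = v] w]).
  apply: measurableC.
  exact: (@sigma_seq _ _ (sigma_algebra_measurable T) _ l _ (fun v _ => mZ v)).
apply/seteqP; split => w /=; first by move=> /negP Zl [v vl E]; apply: Zl; rewrite E.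
by move=> nex; apply/negP => Zl; apply: nex; exists (Z w).
Qed.

Lemma pr_value_split (V : eqType) (Z : T -> V) A (l : seq V) : uniq l -> measurable A ->
  (forall v, measurable [set w | Z w = v]) ->
  pr (A `&` [set w | Z w \notin l]) + \sum_(v <- l) pr (A `&` [set w | Z w = v]) <= pr A.
Proof.
move=> ul mA mZ.
have mN (k : seq V) := measurableI _ _ mA (measurable_notin k mZ).
elim: l ul => [_|v l IH /= /andP[vl ul]].
  by rewrite big_nil addr0; apply: pr_le => //; exact: subIsetl.
apply: le_trans (IH ul); rewrite big_cons addrA lerD2r.
rewrite -pr_disjointU //.
- apply: pr_le => //; first by apply: measurableU => //; exact: measurableI.
  move=> w [[Aw]|[Aw]] /=; first by rewrite inE negb_or => /andP[_].
  by move=> ->.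
- exact: measurableI.
- by rewrite predeqE => w; split => // -[[_ /=]]; rewrite inE => /[swap] -[_ /= ->]; rewrite eqxx.
Qed.

Lemma pr_bigcup_le (A : nat -> set T) (C : R) : (forall k, measurable (A k)) ->
  (forall k, A k `<=` A k.+1) -> (forall k, pr (A k) <= C) -> pr (\bigcup_k A k) <= C.
Proof.
move=> mA AS AC; have mU : measurable (\bigcup_k A k) by exact: bigcupT_measurable.
have nd : nondecreasing_seq A.
  by apply/nondecreasing_seqP => k; apply/subsetPset; exact: AS.
have H := @nondecreasing_cvg_mu _ _ _ P A mA mU nd.
rewrite -lee_fin -prE //; apply: (cvge_le _ H) => //.
by apply: nearW => k; rewrite /= prE // lee_fin.
Qed.

Lemma cond_prob_bound (F : set (set T)) B (Y : T -> R) A c rh :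
  0 <= rh -> is_cond_prob P F B Y -> F A -> measurable A -> measurable B ->
  {ae P, forall w, A w -> `|Y w - c| <= rh} -> `|pr (A `&` B) - c * pr A| <= rh * pr A.
Proof.
move=> rh0 [_ iY YE] FA mA mB ae_bound.
have iYA : P.-integrable A (EFin \o Y) by apply: integrableS iY.
have ic : P.-integrable A (EFin \o cst c) by exact: finite_measure_integrable_cst.
pose f : T -> \bar R := ((EFin \o Y) \- (EFin \o cst c))%E.
have E : (\int[P]_(w in A) f w = (pr (A `&` B) - c * pr A)%:E)%E.
  rewrite integralB //= YE // integral_cst // prE; last exact: measurableI.
  by rewrite EFinB EFinM -(prE mA).
rewrite -lee_fin -abse_EFin -E.
have mf : measurable_fun A f.
  by apply: emeasurable_funB; [case/integrableP: iYA|case/integrableP: ic].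
apply: le_trans (le_abse_integral _ _ _) _ => //.
apply: (@le_trans _ _ (\int[P]_(w in A) (cst rh%:E w))%E); last first.
  by rewrite integral_cst // EFinM -(prE mA).
apply: ae_ge0_le_integral => //.
exact: measurableT_comp.
Qed.

End RealProbability.

(** * Exponential moments of the arrival times, from the infinitesimal jump rates *)

Section ArrivalBound.
Variables (R : realType) (d : measure_display) (T : measurableType d).
Variables (V : choiceType) (e : rel V) (nb : V -> seq V) (o : V) (a : R) (D : nat).
Variables (P : probability T R) (X : T -> R -> V).
Hypothesis e_irr : irreflexive e.
Hypothesis nbE : forall x y, (y \in nb x) = e x y.
Hypothesis nb_uniq : forall x, uniq (nb x).
Hypothesis nb_size : forall x, (size (nb x) <= D)%N.
Hypothesis nb_nonempty : forall x, (0 < size (nb x))%N.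
Hypothesis a01 : 0 < a < 1.
Hypothesis X_measurable : forall t v, 0 <= t -> measurable [set w | X w t = v].
Hypothesis X_path : forall w,
  [/\ X w 0 = o, right_continuous_path (X w) & nearest_neighbour_path e (X w)].
Variable r : R -> R.
Hypothesis r_o : r =o_ (0^'+) (id : R -> R).
Hypothesis X_rate : forall t h i j, 0 <= t -> 0 < h -> e i j ->
  exists2 Y : T -> R,
    is_cond_prob P (natural_filtration X t) [set w | X w (t + h) = j] Y &
    {ae P, forall w, X w t = i -> `|Y w - h * jump_rate a (X w) t i j| <= r h}.
Hypothesis X_two : forall t h, 0 <= t -> 0 < h ->
  (P [set w | two_jumps (X w) t (t + h)] <= (r h)%:E)%E.

Let reach n s t := [set w | reached (X w) n s t].
Let live n s t := [set w | alive (X w) n s t].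

Let mReach n s t : 0 <= t -> s \in histories nb o n -> measurable (reach n s t).
Proof. exact: (reached_measurable e_irr nbE X_measurable X_path). Qed.

Let mLive n s t : 0 <= t -> s \in histories nb o n -> measurable (live n s t).
Proof. exact: (alive_measurable e_irr nbE X_measurable X_path). Qed.

Lemma r_ge0 h : 0 < h -> 0 <= r h.
Proof. by move=> h0; have := X_two (lexx 0) h0; rewrite -lee_fin; apply: le_trans. Qed.

Lemma histories_cons n j s : s \in histories nb o n -> j \in nb (head o s) ->
  j :: s \in histories nb o n.+1.
Proof. by move=> sn js; apply/allpairsPdep; exists s, j. Qed.

Lemma live_step n s t h j : 0 <= t -> 0 < h -> s \in histories nb o n ->
  j \in nb (head o s) ->
  `|pr P (live n s t `&` [set w | X w (t + h) = j]) - h * rate o a s j * pr P (live n s t)|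
    <= r h.
Proof.
move=> t0 h0 sn js; have [|Y YP Yae] := @X_rate t h (head o s) j t0 h0; first by rewrite -nbE.
have h1 : pr P (live n s t) <= 1.
  by rewrite -(prT P); apply: pr_le => //; exact: mLive.
apply: (@le_trans _ _ (r h * pr P (live n s t))); last by rewrite ler_piMr ?r_ge0.
apply: (cond_prob_bound (r_ge0 h0) YP) => //.
- exact: (alive_filtration e_irr nbE X_path).
- exact: mLive.
- by apply: X_measurable; rewrite addr_ge0 // ltW.
case: Yae => N [mN PN sub]; exists N; split => // w /= nle; apply: sub => /= H.
apply: nle => al; have [_ rc _] := X_path w; rewrite -(jump_rate_alive rc _ _ _ al).
by apply: H; exact: alive_pos al.
Qed.

(** A chain alive at t + h is at the end of [s], hence not at a neighbour of it. If it was already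
    alive at t, this excludes mass total rate times h, up to one error [r h] per neighbour;
    otherwise [s] was reached in between. *)
Lemma alive_decrease n s t h : 0 <= t -> 0 < h -> s \in histories nb o n ->
  pr P (live n s (t + h)) <= (1 - total_rate nb o a s * h) * pr P (live n s t)
    + (pr P (reach n s (t + h)) - pr P (reach n s t)) + D%:R * r h.
Proof.
move=> t0 h0 sn; have th0 : 0 <= t + h by rewrite addr_ge0 // ltW.
have mL := mLive t0 sn; have mR := mReach t0 sn; have mR' := mReach th0 sn.
have mX v : measurable [set w | X w (t + h) = v] by exact: X_measurable.
have mN := measurable_notin (nb (head o s)) mX.
apply: (@le_trans _ _ (pr P ((live n s t `&` [set w | X w (t + h) \notin nb (head o s)]) `|`
    (reach n s (t + h) `\` reach n s t)))).
  apply: pr_le.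
  - exact: mLive.
  - by apply: measurableU; [exact: measurableI|exact: measurableD].
  move=> w.
  have tth : t <= t + h by rewrite lerDl ltW.
  move=> /(aliveS o tth) [[al E]|[re nre]]; [left; split => //=|by right].
  by rewrite E nbE e_irr.
apply: le_trans (pr_U_le _ _ _) _; [exact: measurableI|exact: measurableD|].
have -> : pr P (reach n s (t + h) `\` reach n s t) =
    pr P (reach n s (t + h)) - pr P (reach n s t).
  have RR' : reach n s t `<=` reach n s (t + h).
    by move=> w; apply: reached_le; rewrite lerDl ltW.
  by have := pr_split P mR' mR; rewrite (setIidr RR') => ->; rewrite addrAC subrr add0r.
have := pr_value_split P (nb_uniq (head o s)) mL mX.
have : \sum_(v <- nb (head o s)) (h * rate o a s v * pr P (live n s t) - r h) <=
   \sum_(v <- nb (head o s)) pr P (live n s t `&` [set w | X w (t + h) = v]).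
  rewrite big_seq [leRHS]big_seq; apply: ler_sum => j js.
  have := live_step t0 h0 sn js; rewrite ler_norml => /andP[H _].
  by rewrite lerBrDr addrC in H.
rewrite big_split /= sumrN -mulr_suml -mulr_sumr -/(total_rate nb o a s).
rewrite big_const_seq count_predT iter_addr_0 -[r h *+ _]mulr_natl.
have : (size (nb (head o s)))%:R * r h <= D%:R * r h.
  by rewrite ler_wpM2r ?r_ge0 // ler_nat.
lra.
Qed.

(** The term [r (2 * h)] pays for two jumps by time t + h: the open interval from t to t + 2h
    contains the endpoint t + h. *)
Lemma arrival_increase n s j t h : 0 <= t -> 0 < h -> s \in histories nb o n ->
  j \in nb (head o s) ->
  pr P (reach n.+1 (j :: s) (t + h)) - pr P (reach n.+1 (j :: s) t) <=
  h * rate o a s j * pr P (live n s t) + (r h + r (2 * h)).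
Proof.
move=> t0 h0 sn js; have th0 : 0 <= t + h by rewrite addr_ge0 // ltW.
have jsn := histories_cons sn js.
have mL := mLive t0 sn; have mR := mReach t0 jsn; have mR' := mReach th0 jsn.
have mX v : measurable [set w | X w (t + h) = v] by exact: X_measurable.
have h20 : 0 < 2 * h by rewrite mulr_gt0.
have mtwo : measurable [set w | two_jumps (X w) t (t + 2 * h)].
  exact: (two_jumps_measurable e_irr nbE X_measurable X_path).
have two : pr P [set w | two_jumps (X w) t (t + 2 * h)] <= r (2 * h).
  by rewrite -lee_fin -prE // X_two.
have := live_step t0 h0 sn js; rewrite ler_norml => /andP[_ step].
have : pr P (reach n.+1 (j :: s) (t + h)) <= pr P (reach n.+1 (j :: s) t `|`
    ((live n s t `&` [set w | X w (t + h) = j]) `|` [set w | two_jumps (X w) t (t + 2 * h)])).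
  apply: pr_le => //.
    by apply: measurableU => //; apply: measurableU => //; exact: measurableI.
  move=> w rw; have [_ rc _] := X_path w.
  have [rt|nrt] := pselect (reached (X w) n.+1 (j :: s) t); [by left|right].
  apply: (@reachedS_or_two_jumps _ _ _ o n j s t (t + h)) => //; lra.
move/le_trans => /(_ _ (pr_U_le _ _ _)) H.
have := H mR (measurableU _ _ (measurableI _ _ mL (mX j)) mtwo).
have := pr_U_le P (measurableI _ _ mL (mX j)) mtwo.
lra.
Qed.

Lemma r_small c : 0 < c -> exists2 h0, 0 < h0 & forall h, 0 < h -> h < h0 -> r h <= c * h.
Proof.
move=> c0; have /eqoP/(_ c c0) := r_o.
rewrite /at_right near_withinE => /nbhs_ballP [h0 /= h00 H]; exists h0 => // h hp hh.
have := H h; rewrite /ball /= sub0r normrN gtr0_norm // => /(_ hh hp).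
exact: le_trans (ler_norm _).
Qed.

Lemma discretisation_error tmax eta delta : 0 < tmax -> 0 <= eta -> 0 < delta ->
  exists K0, forall K, (K0 <= K)%N -> let h := tmax / K%:R in
    let w := (1 - eta * h)^-1 in
    [/\ (0 < K)%N, eta * h < 1, K%:R * w ^+ K * (D%:R * r h) <= delta &
        K%:R * w ^+ K * (r h + r (2 * h)) <= delta].
Proof.
move=> T0 eta0 delta0.
have DE0 : 0 < expR (2 * eta * tmax) * (D%:R + 3) * tmax.
  by rewrite !mulr_gt0 ?expR_gt0 // ltr_wpDl.
(* The K grid steps have total length [tmax] and [w ^+ K] is at most the exponential. The number
   [D%:R + 3] covers both errors: D from [D%:R * r h], and 1 + 2 from [r h + r (2 * h)]. *)
pose c := delta / (expR (2 * eta * tmax) * (D%:R + 3) * tmax).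
have c0 : 0 < c by rewrite divr_gt0.
have [h0 h00 rh] := r_small c0.
(* The first summand ensures 2 eta h < 1, the second 2h < h0. *)
exists (Num.bound (2 * eta * tmax + 2 * tmax / h0)).+1 => K K0 h w.
have K1 : (0 < K)%N by apply: leq_trans K0.
have Kgt0 : 0 < K%:R :> R by rewrite ltr0n.
have et0 : 0 <= 2 * eta * tmax by rewrite !mulr_ge0 // ltW.
have th0 : 0 <= 2 * tmax / h0 by rewrite divr_ge0 ?mulr_ge0 // ltW.
have Kbig : 2 * eta * tmax + 2 * tmax / h0 < K%:R.
  apply: lt_le_trans (archi_boundP (addr_ge0 et0 th0)) _.
  by rewrite ler_nat ltnW.
have hp : 0 < h by rewrite divr_gt0.
have Kh : K%:R * h = tmax by rewrite /h mulrC divfK // lt0r_neq0.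
have eh : 2 * (eta * h) < 1.
  rewrite -(ltr_pM2l Kgt0) mulr1 [ltLHS](_ : _ = 2 * eta * (K%:R * h)); last by ring.
  by rewrite Kh; apply: le_lt_trans Kbig; rewrite lerDl.
have hh : 2 * h < h0.
  rewrite -(ltr_pM2l Kgt0) mulrCA Kh -ltr_pdivrMr //.
  by apply: le_lt_trans Kbig; rewrite lerDr.
have w0 : 0 < w by rewrite /w invr_gt0; lra.
(* Uses 1 / (1 - y) <= 1 + 2y <= e^(2y) for y = eta h, which lies between 0 and 1/2. *)
have wK : w ^+ K <= expR (2 * eta * tmax).
  rewrite -Kh (_ : 2 * eta * (K%:R * h) = (2 * eta * h) * K%:R); last by ring.
  rewrite expRM_natr; apply: lerXn2r; rewrite ?nnegrE ?expR_ge0 // ?(ltW w0) //.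
  rewrite /w -[leLHS]mul1r ler_pdivrMr; last by lra.
  apply: (@le_trans _ _ ((1 + 2 * eta * h) * (1 - eta * h))).
    have : 0 <= eta * h by rewrite mulr_ge0 // ltW.
    set y := eta * h in eh *; rewrite -(mulrA 2) -/y => y0.
    rewrite -subr_ge0 (_ : _ - _ = y * (1 - 2 * y)); last by ring.
    by rewrite mulr_ge0 // subr_ge0 ltW.
  by rewrite ler_wpM2r ?expR_ge1Dx //; lra.
have bound E : E <= c * ((D%:R + 3) * h) -> 0 <= E -> K%:R * w ^+ K * E <= delta.
  move=> EE E0; apply: (@le_trans _ _ (K%:R * expR (2 * eta * tmax) * (c * ((D%:R + 3) * h)))).
    apply: ler_pM => //; first by rewrite mulr_ge0 // exprn_ge0 // ltW.
    by rewrite ler_wpM2l // ltW.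
  rewrite [leLHS](_ : _ = c * (expR (2 * eta * tmax) * (D%:R + 3) * (K%:R * h))); last by ring.
  by rewrite Kh /c divfK // lt0r_neq0.
have r1 : r h <= c * h by apply: rh => //; lra.
have r2 : r (2 * h) <= c * (2 * h) by apply: rh => //; lra.
have ch : 0 <= c * h by rewrite mulr_ge0 // ltW.
have D0 : 0 <= D%:R :> R by [].
split => //; first by lra.
- apply: bound; last by rewrite mulr_ge0 // r_ge0.
  apply: le_trans (ler_wpM2l D0 r1) _; rewrite mulrCA ler_wpM2l ?(ltW c0) //.
  by rewrite ler_wpM2r ?(ltW hp) // lerDl.
- apply: bound; last by rewrite addr_ge0 // r_ge0 // mulr_gt0.
  apply: le_trans (lerD r1 r2) _; rewrite -mulrDr ler_wpM2l ?(ltW c0) //.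
  rewrite -[X in X + _]mul1r -mulrDl ler_wpM2r ?(ltW hp) //; lra.
Qed.

Lemma laplace_arrival tmax eta n s delta : 0 < tmax -> 0 <= eta -> eta < a -> 0 < delta ->
  s \in histories nb o n ->
  exists K0, forall K, (K0 <= K)%N ->
    laplace (1 - eta * (tmax / K%:R))^-1 (fun k => pr P (reach n s (k%:R * (tmax / K%:R)))) K
      <= weight nb o a eta s + delta.
Proof.
move=> T0 eta0 eta_a; elim: n s delta => [|n IH] s delta delta0 sn.
  exists 1%N => K K1; set h := tmax / _; have hp : 0 < h by rewrite divr_gt0 // ltr0n.
  have E k : pr P (reach 0 s (k%:R * h)) = 1.
    rewrite -[RHS](prT P); congr pr; apply/seteqP; split => // w _.
    have [X0 _ _] := X_path w; move: sn; rewrite inE => /eqP ->.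
    split; first by rewrite /= /skeleton /= X0.
    by rewrite /= -[0%E]/(0%:E) lee_fin mulr_ge0 // ltW.
  rewrite /laplace E big1 => [|k _]; last by rewrite !E subrr mulr0.
  by move: sn; rewrite inE => /eqP -> /=; rewrite addr0 lerDl ltW.
move: sn => /allpairsPdep [s' [j [s'n js ->]]].
have s'0 := histories_neq0 s'n; rewrite weight_cons //.
set tot := total_rate nb o a s'; set c := rate o a s' j.
have tot_a : a <= tot := total_rate_ge o nb_nonempty a01 s'.
have c0 : 0 < c := rate_gt0 o a01 s' j.
have q0 : 0 < c / (tot - eta) by rewrite divr_gt0 // subr_gt0 (lt_le_trans eta_a).
set q := c / (tot - eta) in q0 *.
(* Two errors, from the shorter history and from [alive_decrease], are multiplied by [q]; the one
   from [arrival_increase] is not. *)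
pose delta' := delta / (2 * q + 1).
have q1 : 0 < 2 * q + 1 by rewrite ltr_wpDl // mulr_ge0 // ltW.
have delta'0 : 0 < delta' by rewrite divr_gt0.
have [K1 HK1] := IH s' delta' delta'0 s'n.
have [K2 HK2] := discretisation_error T0 eta0 delta'0.
exists (maxn K1 K2) => K; rewrite geq_max => /andP[/HK1 + /HK2].
set h := tmax / K%:R; set w := (1 - eta * h)^-1 => /= lap [K0 eh err1 err2].
have hp : 0 < h by rewrite divr_gt0 // ltr0n.
have kh0 k : 0 <= k%:R * h by rewrite mulr_ge0 // ltW.
have khS k : k.+1%:R * h = k%:R * h + h by rewrite -addn1 natrD mulrDl mul1r.
have step : laplace w (fun k => pr P (reach n.+1 (j :: s') (k%:R * h))) K <=
    q * (laplace w (fun k => pr P (reach n s' (k%:R * h))) K + K%:R * w ^+ K * (D%:R * r h))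
    + K%:R * w ^+ K * (r h + r (2 * h)).
  apply: (laplace_step (g := fun k => pr P (live n s' (k%:R * h)))) => //.
  - exact: ltW.
  - exact: lt_le_trans tot_a.
  - by rewrite mulr_ge0 // r_ge0.
  - by rewrite addr_ge0 // r_ge0 // mulr_gt0.
  - by move=> k; exact: pr_ge0.
  - by apply: pr_le; [exact: mLive|exact: mReach|move=> x []].
  - rewrite (_ : reach _ _ _ = set0) ?pr0 // predeqE => x; split => // -[_].
    have [_ rc _] := X_path x; rewrite mul0r leNgt => /negP; case.
    apply: lt_le_trans (jump_time_lt rc (n := 0) _) (jump_time_le rc (_ : (1 <= n.+1)%N)) => //.
    exact: ltry.
  - by move=> k; rewrite (khS k); exact: alive_decrease.
  - by move=> k; rewrite (khS k); exact: arrival_increase.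
apply: le_trans step _.
have : q * (laplace w (fun k => pr P (reach n s' (k%:R * h))) K + K%:R * w ^+ K * (D%:R * r h))
    <= q * (weight nb o a eta s' + delta' + delta').
  by rewrite ler_wpM2l ?(ltW q0) // lerD.
have -> : delta = (2 * q + 1) * delta' by rewrite /delta' mulrC divfK // lt0r_neq0.
rewrite (mulrC (weight _ _ _ _ _) q); lra.
Qed.

Lemma arrived_bound n s eta u : 0 <= eta -> eta < a -> s \in histories nb o n ->
  pr P [set w | arrived X w n s] <=
  pr P (reach n s u) + expR (- (eta * u)) * weight nb o a eta s.
Proof.
move=> eta0 eta_a sn.
have fin k : pr P (reach n s k.+1%:R) <=
    pr P (reach n s u) + expR (- (eta * u)) * weight nb o a eta s.
  rewrite -lerBlDl; apply/ler_addgt0Pl => eps eps0.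
  have k0 : 0 < k.+1%:R :> R by [].
  have E0 : 0 < expR (eta * u) := expR_gt0 _.
  (* The error is taken as [eps] times e^(eta u), since the Markov bound divides it by e^(eta u). *)
  have [K0 HK] := laplace_arrival k0 eta0 eta_a (mulr_gt0 E0 eps0) sn.
  have [K1 HK1] := discretisation_error k0 eta0 eps0.
  have := HK _ (leq_maxl K0 K1); have := HK1 _ (leq_maxr K0 K1).
  move: (maxn K0 K1) => K /=; set h := k.+1%:R / K%:R => -[Kp eh _ _] lap.
  have hp : 0 < h by rewrite divr_gt0 // ltr0n.
  have kh0 l : 0 <= l%:R * h by rewrite mulr_ge0 // ltW.
  have Kh : K%:R * h = k.+1%:R by rewrite /h mulrC divfK // lt0r_neq0 // ltr0n.
  have := @laplace_ge R (fun l => pr P (reach n s (l%:R * h))) h eta u (pr P (reach n s u)) K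
    hp eta0 eh (pr_ge0 _ _) (pr_ge0 _ _).
  rewrite Kh => low; rewrite -(ler_pM2l E0) [leRHS]mulrDr mulrA -expRD subrr expR0 mul1r.
  rewrite [leRHS]addrC; apply: le_trans lap; apply: low => [l|l lu].
    apply: pr_le; [exact: mReach|exact: mReach|move=> w; apply: reached_le].
    by rewrite ler_pM2r // ler_nat.
  apply: pr_le; [exact: mReach|apply: mReach => //|move=> w; exact: reached_le].
  exact: le_trans lu.
have -> : [set w | arrived X w n s] = \bigcup_k reach n s k.+1%:R.
  apply/seteqP; split => w /=; last first.
    by move=> [k _ [ns nk]]; split => //; apply: le_lt_trans nk _; rewrite ltry.
  move=> [ns]; have [->//|[v v0 E]] := jump_time_case (X w) n.
  move=> _; exists (Num.bound v) => //; split => //.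
  by rewrite E lee_fin ltW // (lt_le_trans (archi_boundP v0)) // ler_nat.
apply: pr_bigcup_le => // k; first exact: mReach.
by move=> w; apply: reached_le; rewrite ler_nat.
Qed.

End ArrivalBound.

(** * Return probabilities *)

Lemma infinite_natP (A : set nat) : infinite_set A <-> forall m, exists2 n, (m <= n)%N & A n.
Proof.
split=> [infA m|H finA].
  apply: contrapT => nex; apply: infA; apply: (@sub_finite_set _ _ `I_m) => // n An /=.
  by rewrite ltnNge; apply/negP => mn; apply: nex; exists n.
have [s sE] := (finite_seqP A).1 finA.
have [n sn An] := H (\max_(i <- s) i).+1.
have ns : n \in s by move: An; rewrite sE.
have := @leq_bigmax_seq _ s xpredT id n ns isT; by rewrite leqNgt sn.
Qed.

Lemma borel_cantelli_geometric (R : realType) (d : measure_display) (T : measurableType d)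
    (P : probability T R) (F : nat -> set T) (c q : R) :
  (forall n, measurable (F n)) -> 0 <= c -> 0 <= q < 1 ->
  (forall n, pr P (F n) <= c * q ^+ n) -> P (lim_sup_set F) = 0%E.
Proof.
move=> mF c0 /andP[q0 q1] Fq; apply: lim_sup_set_cvg0 => //.
apply: (@le_lt_trans _ _ (c / (1 - q))%:E); last exact: ltry.
apply: lime_le; first by apply: is_cvg_nneseries => n _ _.
apply: nearW => n.
apply: (@le_trans _ _ (\sum_(0 <= k < n) (c * q ^+ k)%:E)%E).
  by apply: lee_sum => k _; have := Fq k; rewrite -lee_fin -prE.
rewrite sumEFin lee_fin -[leLHS]/(series (geometric c q) n) geometric_seriesE; last first.
  by rewrite lt_eqF.
rewrite /= ler_pM2r ?invr_gt0 ?subr_gt0 // ler_piMr // gerBl exprn_ge0 //.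
Qed.

(** Monotonicity reduces the limit over real times to integer times, which makes the event of a slow
    range a countable combination of measurable events. *)
Lemma cvg_mean0P (R : realType) (N : R -> \bar R) :
  (forall s t, s <= t -> (N s <= N t)%E) -> (forall t, 0 <= N t)%E ->
  ((N t * (t^-1)%:E)%E @[t --> +oo%R] --> 0%E) <->
  (forall m : nat, exists n0 : nat, forall n, (n0 <= n)%N ->
    (N n%:R <= (n%:R / m.+1%:R)%:E)%E).
Proof.
move=> N_le N0; split.
  move=> /fine_cvgP[fin /cvgr0Pnorm_le H] m.
  have m0 : 0 < m.+1%:R^-1 :> R by rewrite invr_gt0.
  have [M [_ HM]] := filterI fin (H _ m0).
  exists (Num.bound `|M|).+1 => n n0.
  have Mn : M < n%:R.
    apply: le_lt_trans (ler_norm M) _; apply: lt_le_trans (archi_boundP (normr_ge0 M)) _.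
    by rewrite ler_nat ltnW.
  have np : 0 < n%:R :> R by rewrite ltr0n; apply: leq_trans n0.
  have [/= fn] := HM _ Mn; move=> /(le_trans (ler_norm _)); rewrite -lee_fin fineK //.
  by rewrite lee_pdivrMr // -EFinM mulrC.
move=> H; have key (eps : R) : 0 < eps -> \forall t \near +oo,
    0 < t /\ (N t <= (eps * t)%:E)%E.
  move=> eps0.
  (* The factor 2 pays for rounding up: the next integer after t is at most 2t once t >= 1. *)
  have [n0 Hn0] := H (Num.bound (2 / eps)).
  exists (n0%:R + 1); split => // t nt.
  have t1 : 1 < t by apply: le_lt_trans nt; rewrite lerDr.
  split; first by apply: lt_trans t1.
  have t0 : 0 < t by apply: lt_trans t1.
  have nt' : t < (Num.truncn t).+1%:R by exact: truncnS_gt.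
  have nt2 : (Num.truncn t).+1%:R <= 2 * t.
    by rewrite -natr1 mulr2n mulrDl mul1r lerD ?truncn_le // ltW.
  have n0n : (n0 <= (Num.truncn t).+1)%N.
    rewrite -(ler_nat R); apply: ltW; apply: lt_trans nt'; apply: le_lt_trans nt.
    by rewrite lerDl.
  apply: le_trans (N_le _ _ (ltW nt')) _; apply: le_trans (Hn0 _ n0n) _.
  rewrite lee_fin ler_pdivrMr //; apply: le_trans nt2 _.
  rewrite mulrAC ler_pM2r // -ler_pdivrMl // mulrC.
  apply: ltW; apply: lt_le_trans (archi_boundP _) _; first by rewrite divr_ge0 // ltW.
  by rewrite ler_nat.
have bnd (eps t : R) : 0 < t -> (N t <= (eps * t)%:E)%E ->
    (N t * (t^-1)%:E <= eps%:E)%E /\ (N t * (t^-1)%:E)%E \is a fin_num.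
  move=> t0 Nt; have le : (N t * (t^-1)%:E <= eps%:E)%E.
    by rewrite lee_pdivrMr // -EFinM.
  split => //; rewrite ge0_fin_numE ?(le_lt_trans le) ?ltry //.
  by rewrite mule_ge0 // lee_fin invr_ge0 ltW.
apply/fine_cvgP; split.
  by near=> t; have [] := bnd 1 t _ _; near: t; apply: filterS (key 1 ltr01) => t [].
apply/cvgr0Pnorm_le => eps eps0; near=> t.
have [t0 Nt] : 0 < t /\ (N t <= (eps * t)%:E)%E by near: t; exact: key.
have [le fin] := bnd _ _ t0 Nt; rewrite /= ger0_norm ?fine_ge0 //.
  by rewrite -lee_fin fineK.
by rewrite mule_ge0 // lee_fin invr_ge0 ltW.
Unshelve. all: by end_near. Qed.

(** * Neighbour lists and the explicit spectral bound of a non-amenable graph *)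

Section Neighbours.
Variables (R : realType) (V : choiceType) (e : rel V) (o : V).

Definition neighbours x : seq V := enum_fset (fset_set [set y | e x y]).

Hypothesis e_sym : symmetric e.
Variable D : nat.
Hypothesis e_deg : forall x, ([set y | e x y] #<= `I_D)%card.

Lemma neighboursE x y : (y \in neighbours x) = e x y.
Proof.
have fin : finite_set [set y | e x y] by apply/finite_set_leP; exists D.
rewrite -[LHS]/(y \in fset_set [set y | e x y]) in_fset_set //.
by apply/idP/idP => [/set_mem|xy]; last exact/mem_set.
Qed.

Lemma neighbours_uniq x : uniq (neighbours x).
Proof. exact: fset_uniq. Qed.

Lemma neighbours_size x : (size (neighbours x) <= D)%N.
Proof. exact: geq_card_fset_set. Qed.

Variable gamma : R.
Hypothesis gamma_gt0 : 0 < gamma.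
Hypothesis gamma_expansion : forall A : set V, finite_set A ->
  (gamma%:E * counting A <= counting (outer_boundary e A))%E.

Lemma boundary_seq (S B : seq V) : uniq S -> uniq B ->
  {in S, forall x, {subset neighbours x <= B}} ->
  gamma * (size S)%:R <=
    (size [seq y <- B | (y \notin S) && has (fun x => e x y) S])%:R.
Proof.
move=> uS uB SB; have := gamma_expansion (finite_seq S).
rewrite counting_finite undup_id // (_ : outer_boundary _ _ =
  [set` [seq y <- B | (y \notin S) && has (fun x => e x y) S]]).
  by rewrite counting_finite undup_id ?filter_uniq // -EFinM lee_fin.
apply/seteqP; split => y /=; rewrite mem_filter.
  move=> [/negP yS [x xS xy]]; rewrite yS; apply/andP; split.
    by apply/hasP; exists x.
  by apply: (SB x xS); rewrite neighboursE.
by move=> /andP[/andP[/negP yS /hasP[x xS xy]] _]; split => //; exists x.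
Qed.

(** Expansion of the single vertex [x] forces its outer boundary to be nonempty. *)
Lemma neighbours_nonempty x : (0 < size (neighbours x))%N.
Proof.
rewrite -has_predT; have := @boundary_seq [:: x] (undup (neighbours x)).
move=> /(_ isT (undup_uniq _)) H.
have {}H : gamma * 1 <= (size [seq y <- undup (neighbours x) | (y \notin [:: x]) &&
    has (fun x => e x y) [:: x]])%:R.
  by apply: H => z; rewrite inE => /eqP -> y; rewrite mem_undup.
rewrite has_predT; case E : (neighbours x) H => [|//] /=.
by rewrite mulr1 leNgt gamma_gt0.
Qed.

(** This is the bound rho on the spectral radius, not its distance to 1. In [t], the summand 2 makes
    rho positive, and 2D / gamma gives 2 / t <= gamma / D. *)
Definition spectral_gap : R :=
  let t := 2 + 2 * D%:R / gamma in (t ^+ 2 - 3) / (t ^+ 2 - 1).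

Lemma spectral_gap_bounds : 0 < spectral_gap < 1.
Proof.
rewrite /spectral_gap; set t := 2 + _.
have t2 : 2 <= t by rewrite lerDl divr_ge0 ?mulr_ge0 // ltW.
have : 4 <= t ^+ 2.
  have -> : 4 = 2 * 2 :> R by ring.
  by rewrite expr2; apply: ler_pM.
move: (t ^+ 2) => u u4; rewrite divr_gt0 ?ltr_pdivrMr; lra.
Qed.

Lemma srw_return_neighbours n :
  iter n (srw neighbours) (dirac_at R o) o <= spectral_gap ^+ n.
Proof.
have D0 : 0 < D%:R :> R.
  by rewrite ltr0n; apply: leq_trans (neighbours_size o); exact: neighbours_nonempty.
have q0 : 0 < 2 * D%:R / gamma by rewrite divr_gt0 // mulr_gt0.
apply: (srw_return e_sym neighboursE neighbours_uniq neighbours_size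
  neighbours_nonempty gamma_gt0 boundary_seq).
  by rewrite lerDl ltW.
rewrite ler_pdivrMr; last by rewrite addr_gt0.
rewrite mulrDr [X in _ <= _ + X](_ : _ = 2); first by rewrite lerDr mulr_ge0 // divr_ge0 // ltW.
by field; rewrite !lt0r_neq0.
Qed.

End Neighbours.

(** * Consequences for ORRW: transience and the slow-range event *)

Section Walk.
Variables (R : realType) (V : choiceType) (e : rel V) (nb : V -> seq V) (o : V) (D : nat).
Hypothesis e_irr : irreflexive e.
Hypothesis nbE : forall x y, (y \in nb x) = e x y.
Hypothesis nb_uniq : forall x, uniq (nb x).
Hypothesis nb_size : forall x, (size (nb x) <= D)%N.
Hypothesis nb_nonempty : forall x, (0 < size (nb x))%N.
Variable rho : R.
Hypothesis rho01 : 0 < rho < 1.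
Hypothesis srw_return_le : forall n, iter n (srw nb) (dirac_at R o) o <= rho ^+ n.

Section FixedWalk.
Variables (a : R) (d : measure_display) (T : measurableType d).
Hypothesis a01 : 0 < a < 1.
Variables (P : probability T R) (X : T -> R -> V).
Hypothesis X_orrw : is_ORRW e a o P X.

Let X_measurable : forall t v, 0 <= t -> measurable [set w | X w t = v].
Proof. by case: X_orrw. Qed.

Let X_path : forall w,
  [/\ X w 0 = o, right_continuous_path (X w) & nearest_neighbour_path e (X w)].
Proof. by case: X_orrw. Qed.

Let M := sigma_algebra_measurable T.

Let marrived n s : s \in histories nb o n -> measurable [set w | arrived X w n s].
Proof. exact: (arrived_measurable e_irr nbE X_measurable X_path). Qed.

Let mreached n s u : s \in histories nb o n -> measurable [set w | reached (X w) n s u].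
Proof.
move=> sn; have [u0|u0] := leP 0 u.
  exact: (reached_measurable e_irr nbE X_measurable X_path).
rewrite (_ : mkset _ = set0) // predeqE => w; split => // -[_ nu].
by have := le_trans (jump_time_ge0 (X w) n) nu; rewrite lee_fin leNgt u0.
Qed.

Lemma arrived_le n s eta u : 0 <= eta -> eta < a -> s \in histories nb o n ->
  pr P [set w | arrived X w n s] <=
  pr P [set w | reached (X w) n s u] + expR (- (eta * u)) * weight nb o a eta s.
Proof.
case: X_orrw => _ _ [r [r_o X_rate X_two]].
exact: (arrived_bound e_irr nbE nb_uniq nb_size nb_nonempty a01 X_measurable X_path
  r_o X_rate X_two).
Qed.

Lemma pr_arrived_le n s : s \in histories nb o n ->
  pr P [set w | arrived X w n s] <= weight nb o a 0 s.
Proof.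
have a0 : 0 < a by case/andP: a01.
(* Nothing is reached by the negative time -1, so with [eta = 0] only the weight remains. *)
move=> /(arrived_le (-1) (lexx 0) a0).
rewrite mul0r oppr0 expR0 mul1r (_ : [set w | reached _ _ _ _] = set0) ?pr0 ?add0r //.
rewrite predeqE => w; split => // -[_ nu].
by have := le_trans (jump_time_ge0 (X w) n) nu; rewrite lee_fin leNgt ltrN10.
Qed.

Lemma pr_histories_le n (p : pred (seq V)) :
  pr P [set w | exists2 s, s \in [seq s <- histories nb o n | p s] & arrived X w n s] <=
  \sum_(s <- histories nb o n | p s) weight nb o a 0 s.
Proof.
rewrite -big_filter; apply: le_trans (pr_seq_le _ _) _ => [s|].
  by rewrite mem_filter => /andP[_ /marrived].
rewrite big_seq [leRHS]big_seq; apply: ler_sum => s; rewrite mem_filter => /andP[_].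
exact: pr_arrived_le.
Qed.

Lemma at_jump_bound n : pr P [set w | at_jump (X w) n o] <= (rho / a) ^+ n.
Proof.
rewrite (at_jumpE nbE X_path); apply: le_trans (pr_histories_le _ _) _.
exact: (sum_weight_return_le nb_nonempty a01 srw_return_le).
Qed.

Let mat_jump n : measurable [set w | at_jump (X w) n o].
Proof. exact: (at_jump_measurable e_irr nbE X_measurable X_path). Qed.

Lemma recurrent_lim_sup :
  [set w | recurrent_path (X w) o] = lim_sup_set (fun n => [set w | at_jump (X w) n o]).
Proof.
apply/seteqP; split => w /=.
  by move=> /infinite_natP H m _; have [n mn An] := H m; exists n.
by move=> H; apply/infinite_natP => m; have [n mn An] := H m I; exists n.
Qed.

Lemma orrw_transient : rho < a -> transient o P X.
Proof.
move=> rho_a; have [a0 _] := andP a01; have [r0 _] := andP rho01.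
exists (lim_sup_set (fun n => [set w | at_jump (X w) n o])); split.
- by apply: bigcap_measurable => // k _; exact: bigcup_measurable.
- apply: (@borel_cantelli_geometric _ _ _ P _ 1 (rho / a)) => //.
    by rewrite divr_ge0 ?ltW //= ltr_pdivrMr // mul1r.
  by move=> n; rewrite mul1r at_jump_bound.
- by rewrite -recurrent_lim_sup => w.
Qed.

(** With [eta = a / 2] and u = 4n / a, the factor e^(-eta u) is e^(-2n); it beats the total weight
    2^n because 2 <= e. *)
Lemma late_jump_bound n :
  pr P [set w | exists2 s, s \in histories nb o n &
     ([set w | arrived X w n s] `\` [set w | reached (X w) n s (4 / a * n%:R)]) w]
  <= expR (-1) ^+ n.
Proof.
have [a0 a1] := andP a01; set u := 4 / a * n%:R.
apply: le_trans (pr_seq_le _ _) _ => [s sn|]; first exact: measurableD (marrived sn) (mreached _ sn).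
apply: (@le_trans _ _ (expR (- (a / 2 * u)) * \sum_(s <- histories nb o n) weight nb o a (a / 2) s)).
  rewrite mulr_sumr big_seq [leRHS]big_seq; apply: ler_sum => s sn.
  have sub : [set w | reached (X w) n s u] `<=` [set w | arrived X w n s].
    by move=> w [ns nu]; split => //; apply: le_lt_trans nu _; rewrite ltry.
  have a20 : 0 <= a / 2 by rewrite divr_ge0 // ltW.
  have a2a : a / 2 < a by lra.
  have := pr_split P (marrived sn) (mreached u sn); rewrite (setIidr sub).
  have := arrived_le u a20 a2a sn; lra.
apply: le_trans (ler_wpM2l (expR_ge0 _) (sum_weight_half o nb_nonempty a01 n)) _.
have -> : - (a / 2 * u) = - 2 * n%:R by rewrite /u; field; exact: lt0r_neq0.
rewrite expRM_natr -exprMn; apply: lerXn2r; rewrite ?nnegrE ?mulr_ge0 ?expR_ge0 //.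
have -> : -2 = -1 - 1 :> R by ring.
rewrite expRD -mulrA ler_piMr ?expR_ge0 // expRN ler_pdivrMl ?expR_gt0 // mulr1.
by have := expR_ge1Dx (1 : R).
Qed.

Lemma counting_traversed_measurable t k : 0 <= t ->
  measurable [set w | (@counting _ R (traversed (X w) t) <= k%:E)%E].
Proof.
move=> t0; rewrite (_ : mkset _ = ~` [set w | exists n, [set w | exists2 s,
    s \in [seq s <- histories nb o n | k < (range_size s)%:R] &
    [set w | reached (X w) n s t] w] w]).
  apply: measurableC; apply: (sigma_countable M) => n; apply: (sigma_seq M) => s.
  by rewrite mem_filter => /andP[_]; exact: mreached.
apply/seteqP; split => w /=; have [X0 rc nn] := X_path w.
  rewrite leNgt => /negP H [n [s]]; rewrite mem_filter => /andP[ks sn] re; apply: H.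
  by apply/(traversed_counting_gt rc nbE nn X0 _ t0); exists n, s.
move=> H; rewrite leNgt; apply/negP.
move=> /(traversed_counting_gt rc nbE nn X0 _ t0) [n [s [sn re ks]]]; apply: H.
by exists n, s; rewrite // mem_filter ks.
Qed.

Lemma slow_rangeP w :
  ((@counting {fset V} R (traversed (X w) t) * (t^-1)%:E)%E @[t --> +oo%R] --> 0%E) <->
  (forall m : nat, exists n0 : nat, forall n, (n0 <= n)%N ->
    (@counting {fset V} R (traversed (X w) n%:R) <= (n%:R / m.+1%:R)%:E)%E).
Proof.
apply: cvg_mean0P => [s t st|t]; last first.
  by rewrite /counting; case: ifP; rewrite ?lee_fin ?leey.
apply: counting_le => _ [n ns <-]; exists n => //.
by apply: le_trans ns _; rewrite lee_fin.
Qed.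

Lemma slow_range_measurable :
  measurable [set w | (@counting {fset V} R (traversed (X w) t) * (t^-1)%:E)%E
    @[t --> +oo%R] --> 0%E].
Proof.
rewrite (_ : mkset _ = [set w | forall m : nat, [set w | exists n0 : nat, [set w |
   forall n : nat, [set w | (n0 <= n)%N ->
    (@counting {fset V} R (traversed (X w) n%:R) <= (n%:R / m.+1%:R)%:E)%E] w] w] w]).
  apply: (sigma_countableI M) => m; apply: (sigma_countable M) => n0.
  apply: (sigma_countableI M) => n; have [n0n|n0n] := boolP (n0 <= n)%N; last first.
    rewrite (_ : mkset _ = setT); first exact: measurableT.
    by apply/seteqP; split => w.
  rewrite (_ : mkset _ = [set w |
    (@counting {fset V} R (traversed (X w) n%:R) <= (n%:R / m.+1%:R)%:E)%E]).
    exact: counting_traversed_measurable.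
  by apply/seteqP; split => w /=; [apply|].
by apply/seteqP; split => w; move/slow_rangeP.
Qed.

Lemma recurrent_slow_range_null :
  P ([set w | recurrent_path (X w) o] `&`
     [set w | (@counting {fset V} R (traversed (X w) t) * (t^-1)%:E)%E
                @[t --> +oo%R] --> 0%E]) = 0%E.
Proof.
have [a0 a1] := andP a01.
have [eps [beta [eps0 beta0 small]]] :=
  sum_weight_return_small_range nb_nonempty a01 nb_size rho01 srw_return_le.
pose F1 n := [set w | exists2 s, s \in [seq s <- histories nb o n |
  (head o s == o) && ((range_size s)%:R <= eps * n%:R)] & arrived X w n s].
pose F2 n := [set w | exists2 s, s \in histories nb o n &
  ([set w | arrived X w n s] `\` [set w | reached (X w) n s (4 / a * n%:R)]) w].
have mF1 n : measurable (F1 n).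
  apply: (@sigma_seq _ _ M _ _ (fun s => [set w | arrived X w n s])) => s.
  by rewrite mem_filter => /andP[_]; exact: marrived.
have mF2 n : measurable (F2 n).
  by apply: (sigma_seq M) => s sn; exact: measurableD (marrived sn) (mreached _ sn).
have F10 : P (lim_sup_set F1) = 0%E.
  apply: (@borel_cantelli_geometric _ _ _ P _ 2 (expR (- beta))) => //.
    by rewrite expR_ge0 -expR0 ltr_expR oppr_lt0.
  by move=> n; rewrite -expRM_natr; apply: le_trans (pr_histories_le _ _) (small n).
have F20 : P (lim_sup_set F2) = 0%E.
  apply: (@borel_cantelli_geometric _ _ _ P _ 1 (expR (-1))) => //.
    by rewrite expR_ge0 -expR0 ltr_expR oppr_lt0 expR_gt0.
  by move=> n; rewrite mul1r; exact: late_jump_bound.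
have mL F : (forall n, measurable (F n)) -> measurable (lim_sup_set F : set T).
  by move=> mF; apply: bigcap_measurable => // k _; exact: bigcup_measurable.
have sub : [set w | recurrent_path (X w) o] `&`
     [set w | (@counting {fset V} R (traversed (X w) t) * (t^-1)%:E)%E
                @[t --> +oo%R] --> 0%E] `<=` lim_sup_set F1 `|` lim_sup_set F2.
  move=> w [/infinite_natP rec /slow_rangeP slow].
  have [|nF2] := pselect (lim_sup_set F2 w); [by right|left].
  have [N HN] : exists N, forall n, (N <= n)%N -> ~ F2 n w.
    apply: contrapT => nex; apply: nF2 => N _; apply: contrapT => nF; apply: nex.
    by exists N => n Nn Fn; apply: nF; exists n.
  (* The range is inspected at the first integer after 4n / a, which is at most 8n / a; this [m]
     turns the bound there into eps n. *)
  pose m := Num.bound (8 / (a * eps)).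
  have [n0 Hn0] := slow m.
  (* The lower bound 1 on [n] gives 4n / a >= 1, which is used for that rounding. *)
  move=> j _; have [n + [nf no]] := rec (maxn j (maxn N (maxn n0 1))).
  rewrite !geq_max => /and4P[jn Nn n0n n1].
  have [X0 rc nn] := X_path w.
  have hn := history_histories rc nbE nn X0 nf.
  exists n => //; exists (history (X w) n) => //.
  rewrite mem_filter hn head_history no eqxx andbT /=.
  have re : reached (X w) n (history (X w) n) (4 / a * n%:R).
    by apply: contrapT => nre; apply: (HN n Nn); exists (history (X w) n).
  have np : 0 < n%:R :> R by rewrite ltr0n.
  have a4 : 1 <= 4 / a by rewrite ler_pdivlMr //; lra.
  set k := (Num.truncn (4 / a * n%:R)).+1.
  have k1 : 4 / a * n%:R < k%:R by exact: truncnS_gt.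
  have k2 : k%:R <= 8 / a * n%:R.
    have n1' : 1 <= n%:R :> R by rewrite ler1n.
    have : 1 <= 4 / a * n%:R by rewrite -[leLHS]mul1r ler_pM.
    rewrite (_ : k%:R = (Num.truncn (4 / a * n%:R))%:R + 1); last by rewrite natr1.
    move=> c1; have : (Num.truncn (4 / a * n%:R))%:R <= 4 / a * n%:R.
      by rewrite truncn_le mulr_ge0 // divr_ge0 // ltW.
    have -> : 8 / a * n%:R = 4 / a * n%:R + 4 / a * n%:R by field; exact: lt0r_neq0.
    by move=> c2; exact: lerD.
  have n0k : (n0 <= k)%N.
    rewrite -(ler_nat R); apply: ltW; apply: le_lt_trans k1.
    by apply: (@le_trans _ _ n%:R); [rewrite ler_nat|rewrite ler_peMl // ltW].
  have rek := reached_le (ltW k1) re.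
  rewrite -lee_fin -counting_finite; apply: le_trans (counting_le _ (traversed_history rc rek.2)) _.
  apply: le_trans (Hn0 k n0k) _; rewrite lee_fin ler_pdivrMr //.
  apply: le_trans k2 _; rewrite [leRHS]mulrAC ler_pM2r //.
  have -> : 8 / a = eps * (8 / (a * eps)) by field; rewrite !lt0r_neq0.
  rewrite ler_pM2l //; apply: ltW; apply: lt_trans (archi_boundP _) _.
    by rewrite divr_ge0 // ltW // mulr_gt0.
  by rewrite ltr_nat.
apply/eqP; rewrite -measure_le0.
apply: le_trans (le_measure P _ _ sub) _; rewrite ?inE.
- apply: measurableI; last exact: slow_range_measurable.
  by rewrite recurrent_lim_sup; exact: mL.
- by apply: measurableU; exact: mL.
apply: le_trans (measureU2 _ _ _) _; [exact: mL|exact: mL|].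
by rewrite [X in (X + _)%E]F10 [X in (_ + X)%E]F20 adde0.
Qed.

End FixedWalk.
End Walk.

Theorem theorem1p2 (R : realType) (V : choiceType) (e : rel V) (o : V)
    (Gsimple : simple_graph e) (Gconn : connected_graph e)
    (Gdeg : bounded_degree e) (Gna : non_amenable e R) :
  (exists2 aG : R, 0 < aG < 1 &
    forall a : R, aG < a < 1 ->
      (exists C beta : R, [/\ 0 < C, 0 < beta &
        forall (d : measure_display) (T : measurableType d)
          (P : probability T R) (X : T -> R -> V),
          is_ORRW e a o P X ->
          forall n : nat,
            (P [set w | at_jump (X w) n o]
               <= (C * expR (- beta * n%:R))%:E)%E]) /\
      (forall (d : measure_display) (T : measurableType d)
         (P : probability T R) (X : T -> R -> V),
         is_ORRW e a o P X -> transient o P X)) /\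
  (forall a : R, 0 < a < 1 ->
    forall (d : measure_display) (T : measurableType d)
      (P : probability T R) (X : T -> R -> V),
      is_ORRW e a o P X ->
      P ([set w | recurrent_path (X w) o] `&`
         [set w | (@counting {fset V} R (traversed (X w) t) * (t^-1)%:E)%E
                    @[t --> +oo%R] --> 0%E]) = 0%E).
Proof.
case: Gsimple => e_sym e_irr; have [D e_deg] := Gdeg.
have [gamma gamma0 gna] := Gna.
have nb_nonempty := neighbours_nonempty e_deg gamma0 gna.
have nb_size := neighbours_size e_deg.
have nbE := neighboursE e_deg.
have nb_uniq := neighbours_uniq e.
have rho01 := spectral_gap_bounds D gamma0.
have srw_le := srw_return_neighbours o e_sym e_deg gamma0 gna.
set rho := spectral_gap D gamma in rho01 srw_le.
have [r0 r1] := andP rho01.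
split; last first.
  move=> a a01 d T P X X_orrw.
  exact: (recurrent_slow_range_null e_irr nbE nb_uniq nb_size nb_nonempty rho01 srw_le a01 X_orrw).
exists rho => // a /andP[ra a1].
have a0 : 0 < a by apply: lt_trans ra.
have a01 : 0 < a < 1 by rewrite a0.
split; last first.
  move=> d T P X X_orrw.
  exact: (orrw_transient e_irr nbE nb_uniq nb_size nb_nonempty rho01 srw_le a01 X_orrw ra).
have q0 : 0 < rho / a by rewrite divr_gt0.
exists 1, (- ln (rho / a)); split => //.
  by rewrite oppr_gt0 ln_lt0 // q0 ltr_pdivrMr // mul1r.
move=> d T P X X_orrw n; rewrite opprK mul1r expRM_natr lnK //.
have [X_measurable X_path _] := X_orrw.
rewrite prE; last exact: (at_jump_measurable e_irr nbE X_measurable X_path).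
rewrite lee_fin.
exact: (at_jump_bound e_irr nbE nb_uniq nb_size nb_nonempty srw_le a01 X_orrw).
Qed.
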